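(* Let $T=\{(x,y)\in\mathbb{R}^2: x+y>0\}$ and $\overline T=\{(x,y)\in\mathbb{R}^2: x+y\ge 0\}$, with the product order from $\mathbb{R}^2$. (i) Every pointwise finite-dimensional middle exact persistence module $M\colon T\to\mathbf{Vec}$ is isomorphic to a direct sum of modules $k_{J\cap T}$ with $J\subseteq\mathbb{R}^2$ a block and $J\cap T\neq\emptyset$. (ii) Every pointwise finite-dimensional middle exact persistence module $N\colon \overline T\to\mathbf{Vec}$ is isomorphic to a direct sum of modules $k_{J\cap \overline T}$ with $J\subseteq\mathbb{R}^2$ a block and $J\cap\overline T\ne\emptyset$.
   Context: $\mathbb{R}^2$ has the product order $(x,y)\le(x',y')$ iff $x\le x'$ and $y\le y'$. Persistence modules over a poset are functors to $k$-vector spaces with structure maps $M(p\le q)$; pointwise finite-dimensional means each $M_p$ finite-dimensional. For $Q\in\{T,\overline T\}$, a module $M\colon Q\to\mathbf{Vec}$ is middle exact if for all $x\le x'$, $y\le y'$ with $a=(x,y)$, $b=(x,y')$, $c=(x',y)$, $d=(x',y')$ all in $Q$, the sequence $M_a\xrightarrow{(M(a\le b),M(a\le c))}M_b\oplus M_c\xrightarrow{M(b\le d)-M(c\le d)}M_d$ is exact at the middle. A block in $\mathbb{R}^2$ is a non-empty subset of one of the forms: (db) $J_1\times J_2$ with $J_1,J_2\subseteq\mathbb{R}$ non-empty downward-closed; (bb) $J_1\times J_2$ with $J_1,J_2$ non-empty upward-closed; (vb) $J_1\times\mathbb{R}$ with $J_1$ a non-empty convex subset of $\mathbb{R}$; (hb)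 $\mathbb{R}\times J_2$ with $J_2$ non-empty convex. For a subset $B$ of the indexing poset, $k_B$ is $k$ on $B$, $0$ elsewhere, with identity maps between points of $B$ and zero maps otherwise. *)

(* Defs.v *)
From Stdlib Require Import Reals List.
From HB Require Import structures.
From mathcomp Require Import all_boot all_order all_algebra.

Set Implicit Arguments.
Unset Strict Implicit.
Unset Printing Implicit Defensive.

Import GRing.Theory.

Definition pt2 : Type := (R * R)%type.
Definition le2 (p q : pt2) : Prop := Rle (fst p) (fst q) /\ Rle (snd p) (snd q).

Definition Tset (p : pt2) : Prop := Rlt 0 (fst p + snd p).
Definition Tbar (p : pt2) : Prop := Rle 0 (fst p + snd p).

Definition sub_pt (Q : pt2 -> Prop) : Type := {p : pt2 | Q p}.
Definition le_sub (Q : pt2 -> Prop) (p q : sub_pt Q) : Prop := le2 (proj1_sig p) (proj1_sig q).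

Definition is_pmod (k : fieldType) (Q : pt2 -> Prop) (Msp : sub_pt Q -> vectType k)
  (Mmap : forall p q : sub_pt Q, le_sub p q -> {linear Msp p -> Msp q}) : Prop :=
  (forall (p : sub_pt Q) (h : le_sub p p) (x : Msp p), Mmap p p h x = x) /\
  (forall (p q r : sub_pt Q) (h1 : le_sub p q) (h2 : le_sub q r) (h3 : le_sub p r)
          (x : Msp p), Mmap p r h3 x = Mmap q r h2 (Mmap p q h1 x)).

(* Middle exactness: for a=(x,y), b=(x,y'), c=(x',y), d=(x',y') in Q with
   x<=x', y<=y', the sequence M_a -> M_b (+) M_c -> M_d (second map (u,v) |-> M(b<=d)u - M(c<=d)v)
   is exact at the middle. *)
Definition middle_exact (k : fieldType) (Q : pt2 -> Prop) (Msp : sub_pt Q -> vectType k)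
  (Mmap : forall p q : sub_pt Q, le_sub p q -> {linear Msp p -> Msp q}) : Prop :=
  forall (a b c d : sub_pt Q)
         (hab : le_sub a b) (hac : le_sub a c) (hbd : le_sub b d) (hcd : le_sub c d),
    fst (proj1_sig b) = fst (proj1_sig a) ->
    snd (proj1_sig c) = snd (proj1_sig a) ->
    fst (proj1_sig d) = fst (proj1_sig c) ->
    snd (proj1_sig d) = snd (proj1_sig b) ->
    (forall w : Msp a, (Mmap b d hbd (Mmap a b hab w) - Mmap c d hcd (Mmap a c hac w) = 0)%R) /\
    (forall (u : Msp b) (v : Msp c),
        (Mmap b d hbd u - Mmap c d hcd v = 0)%R ->
        exists w : Msp a, Mmap a b hab w = u /\ Mmap a c hac w = v).

Definition nonempty1 (J : R -> Prop) : Prop := exists t, J t.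
Definition down_closed (J : R -> Prop) : Prop := forall s t, Rle t s -> J s -> J t.
Definition up_closed (J : R -> Prop) : Prop := forall s t, Rle s t -> J s -> J t.
Definition convex1 (J : R -> Prop) : Prop :=
  forall s t u, Rle s t -> Rle t u -> J s -> J u -> J t.

Definition is_block (J : pt2 -> Prop) : Prop :=
  (exists J1 J2 : R -> Prop, nonempty1 J1 /\ nonempty1 J2 /\
      down_closed J1 /\ down_closed J2 /\ (forall p, J p <-> (J1 (fst p) /\ J2 (snd p))))
  \/ (exists J1 J2 : R -> Prop, nonempty1 J1 /\ nonempty1 J2 /\
      up_closed J1 /\ up_closed J2 /\ (forall p, J p <-> (J1 (fst p) /\ J2 (snd p))))
  \/ (exists J1 : R -> Prop, nonempty1 J1 /\ convex1 J1 /\ (forall p, J p <-> J1 (fst p)))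
  \/ (exists J2 : R -> Prop, nonempty1 J2 /\ convex1 J2 /\ (forall p, J p <-> J2 (snd p))).

Definition fin_supp (k : fieldType) (I : Type) (g : I -> k) : Prop :=
  exists l : list I, forall i, ~ In i l -> g i = 0%R.

(* The direct sum  (+)_{i in I} k_{B i}  (B i read as subsets of Q) has at p the
   space of finitely supported g : I -> k with g i = 0 unless p in B i, and
   structure maps  g |-> (i |-> g i  if p,q in B i,  0 otherwise).
   M is isomorphic to it iff there is a natural family of linear bijections
   psi p : M_p -> ((+)_i k_{B i})_p. *)
Definition iso_to_sum (k : fieldType) (Q : pt2 -> Prop) (Msp : sub_pt Q -> vectType k)
  (Mmap : forall p q : sub_pt Q, le_sub p q -> {linear Msp p -> Msp q})
  (I : Type) (B : I -> pt2 -> Prop) : Prop :=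
  exists psi : forall p : sub_pt Q, Msp p -> I -> k,
    (forall p (a : k) (x y : Msp p) (i : I),
        psi p (a *: x + y)%R i = (a * psi p x i + psi p y i)%R) /\
    (forall p (x y : Msp p), psi p x = psi p y -> x = y) /\
    (forall p (g : I -> k),
        (exists x : Msp p, psi p x = g) <->
        (fin_supp g /\ forall i, g i <> 0%R -> B i (proj1_sig p))) /\
    (forall p q (h : le_sub p q) (x : Msp p) (i : I),
        (B i (proj1_sig p) /\ B i (proj1_sig q) -> psi q (Mmap p q h x) i = psi p x i) /\
        (~ (B i (proj1_sig p) /\ B i (proj1_sig q)) -> psi q (Mmap p q h x) i = 0%R)).

Definition block_decomposable (k : fieldType) (Q : pt2 -> Prop) (Msp : sub_pt Q -> vectType k)
  (Mmap : forall p q : sub_pt Q, le_sub p q -> {linear Msp p -> Msp q}) : Prop :=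
  exists (I : Type) (B : I -> pt2 -> Prop),
    (forall i, is_block (B i) /\ exists p : pt2, B i p /\ Q p) /\
    iso_to_sum Mmap B.

(* Main.v *)
Require Import Defs.
From Stdlib Require Import Reals List Lra.
From HB Require Import structures.
From mathcomp Require Import all_boot all_order all_algebra.
From mathcomp Require Import boolp classical_sets.

(** A summand [k_B] of [M] is a pair of natural maps [k_B -> M -> k_B] composing to the identity.
    By Zorn there is a maximal family of pairwise orthogonal such pairs; the common kernel of the
    maps [M -> k_B] is again middle exact, so it suffices to find one block summand in every
    nonzero middle exact module over an up-closed subset of the plane.

    - If some nonzero vector dies both to the right and upwards, such vectors lift along all maps,
      compatibly by middle exactness, and span a copy of [k_D] with [D] a death block; [k_D] is
      injective because [D] is a directed down-set.
    - Otherwise, if some vector dies to the right, the submodule of such vectors is constant along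
      vertical lines, hence is a one-parameter module whose interval summands give vertical blocks
      that split off from [M]; horizontal blocks are obtained by exchanging the coordinates.
    - Otherwise all maps are injective and [M] is the family of intersections [V_x /\ H_y] of two
      filtrations of its colimit; choosing the first jump of one filtration and then of the
      other yields a birth block.

    In each case the interval bounds come from minimal members of chains of subspaces of a single
    finite-dimensional [M p]. *)

Set Implicit Arguments.
Unset Strict Implicit.
Unset Printing Implicit Defensive.

Import GRing.Theory.
Local Open Scope ring_scope.
Local Notation "x <=r y" := (Rle x y) (at level 70).
Local Notation "x <r y" := (Rlt x y) (at level 70).

(** For a mere preorder, maximality is up to equivalence; families of subspaces can then be compared
    by pointwise inclusion. [t0] bounds the empty chain. *)
Lemma zorn_pred (T : Type) (le : T -> T -> Prop) (P : T -> Prop) (t0 : T) :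
  P t0 -> (forall t, le t t) -> (forall r s t, le r s -> le s t -> le r t) ->
  (forall A : T -> Prop, (exists a, A a) -> (forall a, A a -> P a) ->
     (forall a b, A a -> A b -> le a b \/ le b a) ->
     exists t, P t /\ forall s, A s -> le s t) ->
  exists t, P t /\ forall s, P s -> le t s -> le s t.
Proof.
move=> Pt0 lexx letr chain.
pose T' := {t | P t}.
pose R (a b : T') : bool := `[< le (sval a) (sval b) >].
have [| | |[t Pt] tmax] := @ZL_preorder T' (exist _ t0 Pt0) R.
- by move=> t; apply/asboolP.
- by move=> r s t /asboolP rs /asboolP st; apply/asboolP/(letr _ _ _ rs st).
- move=> A totA; have [[a Aa]|nA] := pselect (exists a, A a); last first.
    by exists (exist _ t0 Pt0) => s As; case: nA; exists s.
  have [|||t [Pt tub]] := chain (fun t => exists a, A a /\ sval a = t).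
  + by exists (sval a), a.
  + by move=> _ [[b Pb] [_ <-]].
  + move=> _ _ [b [Ab <-]] [c [Ac <-]].
    by have [/asboolP|/asboolP] := totA _ _ Ab Ac; [left|right].
  + by exists (exist _ t Pt) => s As; apply/asboolP/tub; exists s.
exists t; split=> // s Ps ts.
by have /asboolP := tmax (exist _ s Ps) (asboolT ts : R (exist _ t Pt) (exist _ s Ps)).
Qed.

(** * Subspaces as predicates *)

Section Subspaces.
Variables (k : fieldType) (V : vectType k).
Implicit Types (S T : V -> Prop) (x y : V).

Definition subsp S := S 0 /\ forall a x y, S x -> S y -> S (a *: x + y).

Lemma subspD S x y : subsp S -> S x -> S y -> S (x + y).
Proof. by move=> [_ SD] Sx Sy; rewrite -[x]scale1r; apply: SD. Qed.

Lemma subspZ S a x : subsp S -> S x -> S (a *: x).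
Proof. by move=> [S0 SD] Sx; rewrite -[_ *: _]addr0; apply: SD. Qed.

Lemma subspN S x : subsp S -> S x -> S (- x).
Proof. by move=> sS Sx; rewrite -scaleN1r; apply: subspZ. Qed.

Lemma subspB S x y : subsp S -> S x -> S y -> S (x - y).
Proof. by move=> sS Sx Sy; apply: subspD => //; apply: subspN. Qed.

Lemma subsp_vspace S : subsp S -> exists U : {vspace V}, forall x, S x <-> x \in U.
Proof.
move=> sS; pose P n := `[< exists U : {vspace V}, \dim U = n /\ forall x, x \in U -> S x >].
have exP : exists n, P n.
  exists 0%N; apply/asboolP; exists 0%VS; rewrite dimv0; split=> // x.
  by rewrite memv0 => /eqP->; case: sS.
have ubP n : P n -> (n <= \dim (fullv : {vspace V}))%N.
  by move=> /asboolP[U [<- _]]; apply/dimvS/subvf.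
case: (ex_maxnP exP ubP) => n /asboolP[U [dU US]] nmax.
exists U => x; split=> [Sx|]; last exact: US.
apply: contrapT => /negP xU.
have: P (\dim (U + <[x]>)%VS).
  apply/asboolP; exists (U + <[x]>)%VS; split=> // _ /memv_addP[u uU [_ /vlineP[c ->] ->]].
  by apply: subspD => //; [exact: US|exact: subspZ].
move=> /nmax; rewrite -dU => le_dim.
have /eqP eqU : U == (U + <[x]>)%VS by rewrite eqEdim addvSl.
by move: xU; rewrite eqU (subvP (addvSr _ _)) ?memv_line.
Qed.

Lemma min_subsp (A : (V -> Prop) -> Prop) :
  (exists S, A S) -> (forall S, A S -> subsp S) ->
  exists S, A S /\ forall T, A T -> (forall x, T x -> S x) -> forall x, S x -> T x.
Proof.
move=> [S0 AS0] sA.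
pose P n := `[< exists S (U : {vspace V}), [/\ A S, forall x, S x <-> x \in U & \dim U = n] >].
have exP : exists n, P n.
  have [U SU] := subsp_vspace (sA _ AS0).
  by exists (\dim U); apply/asboolP; exists S0, U.
case: (ex_minnP exP) => n /asboolP[S [U [AS SU dU]]] nmin.
exists S; split=> // T AT TS x Sx.
have [W TW] := subsp_vspace (sA _ AT).
have WU : (W <= U)%VS by apply/subvP => y /TW /TS /SU.
have le_dim : (\dim U <= \dim W)%N by rewrite dU; apply: nmin; apply/asboolP; exists T, W.
have /eqP eqW : W == U by rewrite eqEdim WU.
by apply/TW; rewrite eqW; apply/SU.
Qed.

(** A member of least dimension lies in every comparable one. Some index thus realises the
    intersection of the chain even if the indices have no least element. *)
Lemma chain_min (I : Type) (A : I -> Prop) (F : I -> V -> Prop) :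
  (exists i, A i) -> (forall i, A i -> subsp (F i)) ->
  (forall i j, A i -> A j -> (forall x, F i x -> F j x) \/ (forall x, F j x -> F i x)) ->
  exists i, A i /\ forall j, A j -> forall x, F i x -> F j x.
Proof.
move=> [i0 Ai0] sF tot.
have [||S [[i [Ai <-]] imin]] := @min_subsp (fun S => exists i, A i /\ F i = S).
- by exists (F i0), i0.
- by move=> _ [i [Ai <-]]; apply: sF.
exists i; split=> // j Aj x Fix.
have [ij|ji] := tot _ _ Ai Aj; first exact: ij.
by apply: (imin (F j)) => //; exists j.
Qed.

End Subspaces.

(** * Modules over an up-closed part of the plane *)

(* Points carry coordinates but need not be determined by them; the two axes play symmetric roles. *)
Record plane := Plane {
  pt :> Type;
  cx : pt -> R;
  cy : pt -> R;
  up_pt : forall p x y, cx p <=r x -> cy p <=r y -> {q | cx q = x /\ cy q = y} }.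
Arguments cx {_} _.
Arguments cy {_} _.

Definition ple (P : plane) (p q : P) := cx p <=r cx q /\ cy p <=r cy q.

Lemma ple_refl (P : plane) (p : P) : ple p p.
Proof. by split; apply: Rle_refl. Qed.

Lemma ple_trans (P : plane) (q p r : P) : ple p q -> ple q r -> ple p r.
Proof. by rewrite /ple; lra. Qed.

Definition join (P : plane) (p q : P) : P :=
  sval (up_pt (Rmax_l (cx p) (cx q)) (Rmax_l (cy p) (cy q))).

Lemma cx_join (P : plane) (p q : P) : cx (join p q) = Rmax (cx p) (cx q).
Proof. by rewrite /join; case: up_pt => ? []. Qed.

Lemma cy_join (P : plane) (p q : P) : cy (join p q) = Rmax (cy p) (cy q).
Proof. by rewrite /join; case: up_pt => ? []. Qed.

Ltac coord :=
  unfold ple in *; rewrite ?cx_join ?cy_join;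
  unfold Rmax, Rmin in *; repeat destruct Rle_dec; lra.

Lemma ple_joinl (P : plane) (p q : P) : ple p (join p q).
Proof. coord. Qed.

Lemma ple_joinr (P : plane) (p q : P) : ple q (join p q).
Proof. coord. Qed.

Lemma join_ple (P : plane) (p q r : P) : ple p r -> ple q r -> ple (join p q) r.
Proof. coord. Qed.

#[local] Hint Resolve ple_refl ple_joinl ple_joinr : core.

(* [mv p q] is only meaningful when [ple p q]; it is total to avoid carrying order proofs. *)
Record pmodule (k : fieldType) (P : plane) := PModule {
  sp :> P -> vectType k;
  mv : forall p q, {linear sp p -> sp q};
  mv_id : forall p x, mv p p x = x;
  mv_comp : forall p q r, ple p q -> ple q r -> forall x, mv q r (mv p q x) = mv p r x }.
Arguments mv {k P} _ p q.

Section Module.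
Variables (k : fieldType) (P : plane) (M : pmodule k P).
Implicit Types (p q r s t : P).
Local Notation mv := (mv M).

Definition mexact := forall a b c d, cx b = cx a -> cy c = cy a -> cx d = cx c -> cy d = cy b ->
  ple a b -> ple a c -> forall (u : M b) (v : M c), mv b d u = mv c d v ->
  exists w : M a, mv a b w = u /\ mv a c w = v.

(** By [agreeP] the join alone decides. Without injectivity of the maps this relation need not be
    transitive. *)
Definition agree s t (a : M s) (b : M t) :=
  forall u, ple s u -> ple t u -> mv s u a = mv t u b.

Lemma agreeP s t (a : M s) (b : M t) :
  mv s (join s t) a = mv t (join s t) b -> agree a b.
Proof.
move=> ab u su tu; have ju := join_ple su tu.
by rewrite -(mv_comp (ple_joinl s t) ju) ab mv_comp.
Qed.

Lemma agree_sym s t (a : M s) (b : M t) : agree a b -> agree b a.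
Proof. by move=> ab u tu su; rewrite ab. Qed.

Lemma agree_le s t (a : M s) (b : M t) : ple s t -> agree a b -> mv s t a = b.
Proof. by move=> st /(_ t st (ple_refl t)) ->; rewrite mv_id. Qed.

Lemma agree_mv s t (a : M s) : ple s t -> agree a (mv s t a).
Proof. by move=> st u su tu; rewrite mv_comp. Qed.

(** Incomparable [s] and [t] span a rectangle with corners [r] and the join, so middle exactness
    applies. If they are comparable, [r] has the coordinates of the smaller one, and the maps
    between these two points are mutually inverse. *)
Lemma meet_lift : mexact -> forall r s t, cx r = Rmin (cx s) (cx t) -> cy r = Rmin (cy s) (cy t) ->
  forall (a : M s) (b : M t), agree a b -> exists w : M r, mv r s w = a /\ mv r t w = b.
Proof.
move=> ex r s t rx ry a b ab.
have down s' t' (a' : M s') (b' : M t') : cx r = cx s' -> cy r = cy s' -> ple s' t' ->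
    agree a' b' -> exists w : M r, mv r s' w = a' /\ mv r t' w = b'.
  move=> rx' ry' st' ab'; exists (mv s' r a').
  by rewrite !mv_comp ?mv_id; [rewrite (agree_le st' ab')|coord..].
have [xle|xle] := Rle_dec (cx s) (cx t); have [yle|yle] := Rle_dec (cy s) (cy t).
- by apply: down => //; coord.
- by apply: (ex r s t (join s t)); try apply: ab => //; coord.
- have [|||||||w [w1 w2]] := ex r t s (join s t) _ _ _ _ _ _ b a; try coord.
    by rewrite ab.
  by exists w.
- have [|||w [w1 w2]] := down t s b a _ _ _ (agree_sym ab); try coord.
  by exists w.
Qed.

(** The maps [k_B -> M -> k_B]: [sv] gives the images of the generators, [sphi] the retraction. Both
    vanish outside [sB], so [sv_mv] and [sphi_mv] also express naturality for maps leaving or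
    entering [sB]. *)
Record summand := Summand {
  sB : pt2 -> Prop;
  sv : forall p, M p;
  sphi : forall p, M p -> k;
  sB_block : is_block sB;
  sB_pt : exists p, sB (cx p, cy p);
  sv_out : forall p, ~ sB (cx p, cy p) -> sv p = 0;
  sv_mv : forall p q, sB (cx p, cy p) -> ple p q -> mv p q (sv p) = sv q;
  sphi_lin : forall p a (x y : M p), sphi (a *: x + y) = a * sphi x + sphi y;
  sphi_out : forall p (x : M p), ~ sB (cx p, cy p) -> sphi x = 0;
  sphi_mv : forall p q (x : M p), sB (cx q, cy q) -> ple p q -> sphi (mv p q x) = sphi x;
  sphi_sv : forall p, sB (cx p, cy p) -> sphi (sv p) = 1 }.

Definition submod (D : P -> Prop) (X : forall p, M p -> Prop) :=
  forall q r, D q -> D r -> ple q r -> forall x, X q x -> X r (mv q r x).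

(* Zorn gives a maximal submodule [X >= Z] on [D] missing every [v r]; directedness of [D] makes
   each [X r] a hyperplane complementary to [v r], and [phi] is the projection along [X]. *)
Lemma split_off (J : pt2 -> Prop) (D := fun p => J (cx p, cy p)) (v : forall p, M p)
    (Z : forall p, M p -> Prop) :
  is_block J -> (exists p, D p) ->
  (forall q r, D q -> D r -> exists s, [/\ D s, ple q s & ple r s]) ->
  (forall q r, D q -> D r -> ple q r -> mv q r (v q) = v r) ->
  (forall q r, D q -> ~ D r -> ple q r -> mv q r (v q) = 0) ->
  (forall r, subsp (Z r)) -> submod D Z ->
  (forall q r, ~ D q -> D r -> ple q r -> forall x, Z r (mv q r x)) ->
  (forall r, D r -> ~ Z r (v r)) ->
  inhabited summand.
Proof.
move=> blJ neD dirD vD vout sZ mZ Zin vZ.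
pose ok (X : forall p, M p -> Prop) := [/\ forall r, subsp (X r), submod D X,
  forall r x, Z r x -> X r x & forall r, D r -> ~ X r (v r)].
have [|||A [X0 AX0] Aok Atot|X [[sX mX ZX vX] Xmax]] := @zorn_pred _
  (fun X X' => forall r x, X r x -> X' r x) ok Z.
- by split.
- by [].
- by move=> X1 X2 X3 h12 h23 r x /h12 /h23.
- exists (fun r x => exists X, A X /\ X r x); split; last by move=> X AX r x Xx; exists X.
  split.
  + move=> r; split; first by exists X0; split=> //; case: (Aok _ AX0) => /(_ r)[].
    move=> a x y [X1 [AX1 X1x]] [X2 [AX2 X2y]].
    have [h|h] := Atot _ _ AX1 AX2.
      exists X2; split=> //; case: (Aok _ AX2) => /(_ r)[_ c] _ _ _.
      by apply: c => //; apply: h.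
    exists X1; split=> //; case: (Aok _ AX1) => /(_ r)[_ c] _ _ _.
    by apply: c => //; apply: h.
  + move=> q r Dq Dr qr x [X [AX Xx]]; exists X; split=> //.
    by case: (Aok _ AX) => _ mX _ _; apply: mX.
  + by move=> r x Zx; exists X0; split=> //; case: (Aok _ AX0) => _ _ + _; apply.
  + by move=> r Dr [X [AX]]; case: (Aok _ AX) => _ _ _; apply.
(* If the submodule generated by [X] and [w] still misses every [v t], maximality puts [w] in
   [X]. *)
have ext r (w : M r) : D r ->
    (forall t, D t -> ple r t -> forall c y, X t y -> v t <> y + c *: mv r t w) -> X r w.
  move=> Dr vw.
  pose X' t (x : M t) := X t x \/ (ple r t /\ exists c y, X t y /\ x = y + c *: mv r t w).
  suff: ok X' by move=> /Xmax; apply; [by move=> *; left|right; split=> //;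
    exists 1, 0; rewrite mv_id scale1r add0r; split=> //; case: (sX r)].
  split.
  - move=> t; split; first by left; case: (sX t).
    move=> a x y [Xx|[rt [c [x' [Xx' ->]]]]] [Xy|[rt' [d [y' [Xy' ->]]]]].
    + by left; case: (sX t) => _; apply.
    + right; split=> //; exists d, (a *: x + y'); split; first by case: (sX t) => _; apply.
      by rewrite addrA.
    + right; split=> //; exists (a * c), (a *: x' + y); split; first by case: (sX t) => _; apply.
      by rewrite scalerDr scalerA addrAC.
    + right; split=> //; exists (a * c + d), (a *: x' + y').
      split; first by case: (sX t) => _; apply.
      by rewrite scalerDr scalerA scalerDl addrACA.
  - move=> q t Dq Dt qt x [Xx|[rq [c [x' [Xx' ->]]]]]; first by left; apply: mX.
    right; split; first exact: ple_trans qt.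
    exists c, (mv q t x'); split; first exact: mX.
    by rewrite linearD linearZ mv_comp.
  - by move=> t x /ZX; left.
  - by move=> t Dt [|[rt [c [y [Xy]]]]]; [exact: vX|exact: vw].
(* A relation expressing [v t] through [w] would, at an upper bound [u] of [s] and [t] in [D], put
   [v u] into [X]. *)
have saturated r (w : M r) s : D r -> D s -> ple r s -> X s (mv r s w) -> X r w.
  move=> Dr Ds rs Xw; apply: ext => // t Dt rt c y Xy vE.
  have [u [Du su tu]] := dirD _ _ Ds Dt.
  apply: (vX u Du); rewrite -(vD _ _ Dt Du tu) vE linearD linearZ mv_comp //.
  apply: subspD => //; first exact: mX Xy.
  apply: subspZ => //; rewrite -(mv_comp rs su); exact: mX Xw.
(* In a relation [v s = y + c *: mv r s m] the scalar is nonzero, so [m - c^-1 *: v r] enters [X] at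
   [s] and hence lies in [X] already at [r]. *)
have hyp r (m : M r) : D r -> exists c, X r (m - c *: v r).
  move=> Dr; apply: contrapT => nc.
  suff: X r m by move=> Xm; apply: nc; exists 0; rewrite scale0r subr0.
  apply: ext => // s Ds rs c y Xy vE.
  have c0 : c != 0.
    by apply/eqP => c0; apply: (vX s Ds); rewrite vE c0 scale0r addr0.
  apply: nc; exists c^-1; apply: (saturated r _ s) => //.
  rewrite linearB linearZ_LR vD // vE scalerDr scalerA mulVf // scale1r opprD addrCA subrr addr0.
  by apply: subspN => //; apply: subspZ.
have exphi (m : {r & M r}) : exists c,
    (D (tag m) -> X (tag m) (tagged m - c *: v (tag m))) /\ (~ D (tag m) -> c = 0).
  case: m => r m /=; have [Dr|nDr] := pselect (D r); last by exists 0.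
  by have [c Xc] := hyp r m Dr; exists c.
have [phi phiP] := boolp.choice exphi.
(* Two different coefficients would make [v r] a multiple of a vector of [X r]. *)
have phi_uniq r (m : M r) c : D r -> X r (m - c *: v r) -> phi (Tagged (fun r => M r) m) = c.
  move=> Dr Xc; have [/(_ Dr) /= Xp _] := phiP (Tagged (fun r => M r) m).
  apply/eqP; rewrite -subr_eq0; apply: contrapT => /negP nz.
  apply: (vX r Dr).
  have -> : v r = (phi (Tagged (fun r => M r) m) - c)^-1 *: ((m - c *: v r) - (m - phi (Tagged (fun r => M r) m) *: v r)).
    rewrite opprB [m - _ + _]addrC addrA subrK -scalerBl scalerA mulVf ?scale1r //.
  by apply: subspZ => //; apply: subspB.
pose w p : M p := if pselect (D p) then v p else 0.
have wD p : D p -> w p = v p by rewrite /w; case: pselect.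
have wN p : ~ D p -> w p = 0 by rewrite /w; case: pselect.
constructor; apply: (@Summand J w (fun r m => phi (Tagged (fun r => M r) m))) => //.
- move=> p q Dp pq; rewrite wD //; have [Dq|nDq] := pselect (D q).
    by rewrite wD // vD.
  by rewrite wN // vout.
- move=> r a x y; have [Dr|nDr] := pselect (D r); last first.
    by rewrite !(phiP (Tagged (fun r => M r) _)).2 // mulr0 addr0.
  apply: phi_uniq => //.
  have [/(_ Dr) /= Xx _] := phiP (Tagged (fun r => M r) x); have [/(_ Dr) /= Xy _] := phiP (Tagged (fun r => M r) y).
  have -> : forall b c, a *: x + y - (a * b + c) *: v r = a *: (x - b *: v r) + (y - c *: v r).
    by move=> b c; rewrite scalerBr scalerA addrACA -opprD -scalerDl.
  by case: (sX r) => _; apply.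
- by move=> p x nDp; apply: (phiP (Tagged (fun r => M r) x)).2.
- move=> p q x Dq pq; apply: phi_uniq => //.
  have [Dp|nDp] := pselect (D p).
    rewrite -(vD _ _ Dp Dq pq) -linearZ -linearB.
    by apply: (mX p q) => //; apply: (phiP (Tagged (fun r => M r) x)).1.
  rewrite (phiP (Tagged (fun r => M r) x)).2 // scale0r subr0.
  by apply: ZX; apply: Zin.
- move=> p Dp; apply: phi_uniq => //; rewrite wD // scale1r subrr.
  by case: (sX p).
Qed.

End Module.

(** * Compatible families *)

Section Sections.
Variables (k : fieldType) (P : plane) (M : pmodule k P).
Implicit Types (p q r s t : P).
Local Notation mv := (mv M).

Definition lifting (D : P -> Prop) (X : forall p, M p -> Prop) := forall r s t,
  D r -> D s -> D t -> ple r s -> ple r t -> forall (a : M s) (b : M t), X s a -> X t b ->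
  agree a b -> exists c : M r, [/\ X r c, mv r s c = a & mv r t c = b].

Lemma two_of_three s t w :
  [\/ ple (join t w) (join s w), ple (join w t) (join s t) | ple (join s w) (join t w)].
Proof.
have orP3 (A1 A2 A3 : Prop) : A1 \/ A2 \/ A3 -> [\/ A1, A2 | A3].
  by move=> [|[|]]; [constructor 1|constructor 2|constructor 3].
apply: orP3; unfold ple; rewrite !cx_join !cy_join /Rmax.
repeat destruct Rle_dec; lra.
Qed.

Variable D : P -> Prop.
Hypothesis convD : forall q r s, D q -> D s -> ple q r -> ple r s -> D r.
Hypothesis joinD : forall q r, D q -> D r -> D (join q r).

(* In the plane, one of the three pairwise joins is the join of all three points, so a lift of two
   of the vectors to the meet of their base points still agrees with the third. *)
Lemma lifting3 X : submod D X -> lifting D X -> forall r s t w,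
  D r -> D s -> D t -> D w -> ple r s -> ple r t -> ple r w ->
  forall (a : M s) (b : M t) (c : M w), X s a -> X t b -> X w c ->
  agree a b -> agree a c -> agree b c ->
  exists e : M r, [/\ X r e, mv r s e = a, mv r t e = b & mv r w e = c].
Proof.
move=> mX lX r.
have core s t w : D r -> D s -> D t -> D w -> ple r s -> ple r t -> ple r w ->
    ple (join t w) (join s w) ->
    forall (a : M s) (b : M t) (c : M w), X s a -> X t b -> X w c ->
    agree a b -> agree a c -> agree b c ->
    exists e : M r, [/\ X r e, mv r s e = a, mv r t e = b & mv r w e = c].
  move=> Dr Ds Dt Dw rs rt rw jj a b c Xa Xb Xc ab ac bc.
  have [||z [zx zy]] := @up_pt P r (Rmin (cx s) (cx t)) (Rmin (cy s) (cy t)); try coord.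
  have [rz zs zt] : [/\ ple r z, ple z s & ple z t] by split; coord.
  have Dz : D z by apply: (convD Dr Ds).
  have [e [Xe es et]] := lX z s t Dz Ds Dt zs zt a b Xa Xb ab.
  have ec : agree e c.
    apply: agreeP.
    have tz : ple t (join z w).
      by move: jj; unfold ple; rewrite !cx_join !cy_join zx zy; coord.
    rewrite -(mv_comp zt tz) et; apply: bc => //.
  have [f [Xf fz fw]] := lX r z w Dr Dz Dw rz rw e c Xe Xc ec.
  by exists f; split=> //; rewrite -?es -?et -fz mv_comp.
move=> s t w Dr Ds Dt Dw rs rt rw a b c Xa Xb Xc ab ac bc.
have [j|j|j] := two_of_three s t w.
- exact: (core s t w).
- have [|e [Xe ea ec eb]] := core s w t Dr Ds Dw Dt rs rw rt j a c b Xa Xc Xb ac ab.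
    exact: agree_sym.
  by exists e.
- have [|e [Xe eb ea ec]] := core t s w Dr Dt Ds Dw rt rs rw j b a c Xb Xa Xc _ bc ac.
    exact: agree_sym.
  by exists e.
Qed.

(* A minimal [X <= X0] with the lifting property and containing [m] is a family of lines:
   prescribing the value at one point up to a scalar preserves the lifting property. *)
Lemma compatible_section X0 p (m : M p) :
  (forall r, subsp (X0 r)) -> submod D X0 -> lifting D X0 -> D p -> X0 p m ->
  (forall r, D r -> ple p r -> mv p r m <> 0) ->
  exists v : forall q, M q, [/\ forall q, D q -> X0 q (v q),
    forall q r, D q -> D r -> ple q r -> mv q r (v q) = v r & v p = m].
Proof.
move=> sX0 mX0 lX0 Dp X0m nz.
pose ok (X : forall q, M q -> Prop) := [/\ forall r, subsp (X r), submod D X, lifting D X,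
  X p m & forall r x, X r x -> X0 r x].
have [|||A [X1 AX1] Aok Atot|X [[sX mX lX Xm XX0] Xmin]] := @zorn_pred _
  (fun X X' => forall r x, X' r x -> X r x) ok X0.
- by split.
- by [].
- by move=> X1 X2 X3 h12 h23 r x /h23 /h12.
- exists (fun r x => forall X, A X -> X r x); split; last by move=> X AX r x; apply.
  split.
  + move=> r; split; first by move=> X /Aok[/(_ r)[]].
    by move=> a x y hx hy X AX; have [/(_ r)[_ +] _ _ _ _] := Aok _ AX; apply; [exact: hx|exact: hy].
  + by move=> q r Dq Dr qr x hx X AX; have [_ + _ _ _] := Aok _ AX; apply=> //; apply: hx.
  (* Lifts in different members of the chain may differ; one taken in the member with smallest [X r]
     lies in all of them. *)
  + move=> r s t Dr Ds Dt rs rt a b ha hb ab.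
    have [|||X [AX XA]] := @chain_min _ (M r) _ A (fun X => X r).
    * by exists X1.
    * by move=> X /Aok[].
    * by move=> X X' AX AX'; have [h|h] := Atot _ _ AX AX'; [right|left] => x; apply: h.
    have [_ _ lX _ _] := Aok _ AX.
    have [c [Xc cs ct]] := lX r s t Dr Ds Dt rs rt a b (ha _ AX) (hb _ AX) ab.
    by exists c; split=> // X' AX'; apply: XA.
  + by move=> X /Aok[].
  + by move=> r x /(_ X1 AX1); have [_ _ _ _] := Aok _ AX1; apply.
have line q : D q -> exists v : M q, [/\ X q v, agree v m & forall x, X q x -> exists c, x = c *: v].
  move=> Dq; have Dj := joinD Dq Dp.
  have Xj : X (join q p) (mv p (join q p) m) by apply: mX.
  have [v [Xv vj _]] := lX q _ _ Dq Dj Dj (ple_joinl q p) (ple_joinl q p) _ _ Xj Xj (fun u _ _ => erefl).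
  have vm : agree v m by apply: agreeP.
  exists v; split=> //.
  have vnz u : D u -> ple q u -> mv q u v <> 0.
    move=> Du qu v0; have Dup := joinD Du Dp; apply: (nz (join u p)) => //.
    rewrite -vm //; last exact: ple_trans (ple_joinl _ _).
    by rewrite -(mv_comp qu (ple_joinl _ _)) v0 linear0.
  (* This condition preserves all properties of [X], so by minimality it holds on all of [X]; for
     [r = q] it says that [v] spans [X q]. *)
  pose X' r (x : M r) := X r x /\ (D r -> exists c, mv r (join r q) x = c *: mv q (join r q) v).
  suff okX' : ok X'.
    move=> x Xx; have [_ /(_ Dq)[c xc]] := Xmin X' okX' (fun r x => @proj1 _ _) q x Xx.
    (* [join q q] has the coordinates of [q] but may be another point, hence the transport back. *)
    exists c; have: mv (join q q) q (mv q (join q q) x) = mv (join q q) q (c *: mv q (join q q) v).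
      by rewrite xc.
    by rewrite linearZ_LR !mv_comp ?mv_id //; coord.
  split.
  - move=> r; split.
      split; first by case: (sX r).
      by move=> _; exists 0; rewrite linear0 scale0r.
    move=> a x y [Xx hx] [Xy hy]; split; first by case: (sX r) => _; apply.
    move=> Dr; have [c xc] := hx Dr; have [d yd] := hy Dr; exists (a * c + d).
    by rewrite linearD linearZ_LR xc yd scalerA -scalerDl.
  - move=> s t Ds Dt st x [Xx hx]; split; first exact: mX.
    move=> _; have [c xc] := hx Ds; exists c.
    have sj : ple (join s q) (join t q) by coord.
    by rewrite mv_comp // -(mv_comp (ple_joinl s q) sj) xc linearZ_LR mv_comp.
  - move=> r s t Dr Ds Dt rs rt a b [Xa ha] [Xb hb] ab.
    have [c ac] := ha Ds; have [d bd] := hb Dt.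
    (* The scalars coincide because [v] has nonzero image at every point of [D] above [q]. *)
    have cd : c = d.
      pose u := join (join s q) t.
      have [su tu qu] : [/\ ple s u, ple t u & ple q u] by split; rewrite /u; coord.
      have [su' tu'] : ple (join s q) u /\ ple (join t q) u by split; rewrite /u; coord.
      have := ab u su tu.
      rewrite -(mv_comp (ple_joinl s q) su') -(mv_comp (ple_joinl t q) tu') ac bd !linearZ_LR !mv_comp //.
      move=> /eqP; rewrite -subr_eq0 -scalerBl scaler_eq0 subr_eq0 => /orP[/eqP//|/eqP v0].
      by case: (vnz u) => //; rewrite /u; apply: joinD => //; apply: joinD.
    subst d.
    have Dw := joinD Dr Dq.
    have Xw : X (join r q) (c *: mv q (join r q) v).
      by apply: subspZ => //; apply: mX.
    have agw s' (a' : M s') : ple r s' -> mv s' (join s' q) a' = c *: mv q (join s' q) v ->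
        agree a' (c *: mv q (join r q) v).
      move=> rs' ac' u su wu; have qu := ple_trans (ple_joinr r q) wu.
      rewrite linearZ_LR mv_comp // -(mv_comp (ple_joinl s' q) (join_ple su qu)) ac'.
      by rewrite linearZ_LR mv_comp //; apply: join_ple.
    (* Prescribing a third value, the multiple of [v] at [join r q], forces the lift into [X']. *)
    have [e [Xe es et ew]] := lifting3 mX lX Dr Ds Dt Dw rs rt (ple_joinl r q) Xa Xb Xw ab
      (agw _ _ rs ac) (agw _ _ rt bd).
    by exists e; split=> //; split=> // _; exists c.
  - split=> // _; exists 1; rewrite scale1r; apply/esym/vm => //.
  - by move=> r x [/XX0].
pose v q : M q := if pselect (D q) is left Dq then projT1 (cid (line q Dq)) else 0.
have vP q : D q -> [/\ X q (v q), agree (v q) m & forall x, X q x -> exists c, x = c *: v q].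
  by move=> Dq; rewrite /v; case: pselect => // Dq'; case: cid.
exists v; split.
- by move=> q /vP[/XX0].
- move=> q r Dq Dr qr; have [Xq qm _] := vP q Dq; have [Xr rm /(_ (mv q r (v q)))[|c qc]] := vP r Dr.
    exact: mX.
  have pj := ple_joinr r p; have rj := ple_joinl r p.
  (* Both [v q] and [v r] agree with [m], whose image at [join r p] is nonzero; hence [c = 1]. *)
  have: mv r (join r p) (mv q r (v q)) = mv r (join r p) (c *: v r) by rewrite qc.
  rewrite mv_comp // linearZ_LR qm //; last exact: ple_trans rj.
  rewrite rm // => /eqP; rewrite -[X in X == _]scale1r -subr_eq0 -scalerBl scaler_eq0 subr_eq0.
  move=> /orP[/eqP c1|/eqP m0]; first by rewrite qc -c1 scale1r.
  by case: (nz (join r p)) => //; apply: joinD.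
- by have [_ /agree_le + _] := vP p Dp; rewrite mv_id; apply.
Qed.

End Sections.

(** * Block summands *)

Section Blocks.
Variables (k : fieldType) (P : plane) (M : pmodule k P).
Implicit Types (p q r : P).
Local Notation mv := (mv M).

Lemma nontrivial (V : vectType k) (S : V -> Prop) :
  ~ (forall x, S x -> x = 0) -> exists x, S x /\ x <> 0.
Proof.
move=> nS; apply: contrapT => nx; apply: nS => x Sx; apply: contrapT => x0.
by apply: nx; exists x.
Qed.

Lemma agree_lin s t (c : k) (a a' : M s) (b b' : M t) :
  agree a b -> agree a' b' -> agree (c *: a + a') (c *: b + b').
Proof. by move=> ab ab' u su tu; rewrite !linearD !linearZ_LR ab ?ab'. Qed.

(* For [s <= cx q] this is the zero subspace, since [r = q] is allowed. *)
Definition kerR q s (x : M q) := forall r, ple q r -> s <=r cx r -> mv q r x = 0.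
Definition kerU q s (x : M q) := forall r, ple q r -> s <=r cy r -> mv q r x = 0.

Lemma subsp_kerR q s : subsp (@kerR q s).
Proof.
split=> [r _ _|a x y hx hy r qr sr]; first exact: linear0.
by rewrite linearD linearZ_LR hx ?hy // scaler0 addr0.
Qed.

Lemma subsp_kerU q s : subsp (@kerU q s).
Proof.
split=> [r _ _|a x y hx hy r qr sr]; first exact: linear0.
by rewrite linearD linearZ_LR hx ?hy // scaler0 addr0.
Qed.

Lemma kerR_le q s s' (x : M q) : s <=r s' -> kerR s x -> kerR s' x.
Proof. by move=> ss' hx r qr sr; apply: hx => //; lra. Qed.

Lemma kerU_le q s s' (x : M q) : s <=r s' -> kerU s x -> kerU s' x.
Proof. by move=> ss' hx r qr sr; apply: hx => //; lra. Qed.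

Lemma kerR_mv q q' s (x : M q) : ple q q' -> kerR s x -> kerR s (mv q q' x).
Proof. by move=> qq' hx r qr sr; rewrite mv_comp // hx //; apply: ple_trans qr. Qed.

Lemma kerU_mv q q' s (x : M q) : ple q q' -> kerU s x -> kerU s (mv q q' x).
Proof. by move=> qq' hx r qr sr; rewrite mv_comp // hx //; apply: ple_trans qr. Qed.

Lemma kerR_pt p r (x : M p) : ple p r -> cy r = cy p -> mv p r x = 0 -> kerR (cx r) x.
Proof.
move=> pr ry x0 t pt rt; have rt' : ple r t by coord.
by rewrite -(mv_comp pr rt') x0 linear0.
Qed.

Lemma kerU_pt p r (x : M p) : ple p r -> cx r = cx p -> mv p r x = 0 -> kerU (cy r) x.
Proof.
move=> pr ry x0 t pt rt; have rt' : ple r t by coord.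
by rewrite -(mv_comp pr rt') x0 linear0.
Qed.

Lemma chain_le (V : vectType k) (A : R -> Prop) (F : R -> V -> Prop) :
  (exists i, A i) -> (forall i, A i -> subsp (F i)) ->
  (forall i j x, i <=r j -> F i x -> F j x) ->
  exists i, A i /\ forall j, A j -> forall x, F i x -> F j x.
Proof.
move=> A0 sF mF; apply: chain_min => // i j _ _.
by have [ij|ij] := Rle_dec i j; [left|right] => x; apply: mF => //; lra.
Qed.

Lemma subspI (V : vectType k) (S T : V -> Prop) :
  subsp S -> subsp T -> subsp (fun x => S x /\ T x).
Proof. by move=> [S0 Sl] [T0 Tl]; split=> // a x y [? ?] [? ?]; split; [apply: Sl|apply: Tl]. Qed.

(** [J1] and [J2] bound the block [D]: inside them, no nonzero vector of the chosen subspaces at [p]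
    has died yet. The vectors [E] that die at every column outside [J1] and every row outside [J2]
    have the lifting property on [D], so [compatible_section] yields a copy of [k_D]. *)
Lemma death_block p b c (m : M p) : mexact M ->
  ple p b -> cx b = cx p -> ple p c -> cy c = cy p ->
  m <> 0 -> mv p b m = 0 -> mv p c m = 0 -> inhabited (summand M).
Proof.
move=> ex pb bx pc cy_ m0 mb mc.
pose F s (x : M p) := (kerR (cx c) x /\ kerU (cy b) x) /\ kerR s x.
have sF s : subsp (F s).
  by apply: subspI; [apply: subspI|]; first [exact: subsp_kerR|exact: subsp_kerU].
pose J1 s := forall x, F s x -> x = 0.
have dJ1 : down_closed J1.
  by move=> s t ts Js x [x1 x2]; apply: Js; split=> //; apply: kerR_le x2.
have mR := kerR_pt pc cy_ mc; have mU := kerU_pt pb bx mb.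
have nJc : ~ J1 (cx c) by move=> /(_ m); apply: contra_not m0; apply.
(* [F s0] is the smallest nonzero [F s], so its vectors die at every column outside [J1]. *)
have [|||s0 [nJs0 s0min]] := @chain_le (M p) (fun s => ~ J1 s) F.
- by exists (cx c).
- by move=> *; apply: sF.
- by move=> i j x ij [x1 x2]; split=> //; apply: kerR_le x2.
pose F2 t (x : M p) := F s0 x /\ kerU t x.
have sF2 t : subsp (F2 t) by apply: subspI => //; exact: subsp_kerU.
pose J2 t := forall x, F2 t x -> x = 0.
have dJ2 : down_closed J2.
  by move=> s t ts Js x [x1 x2]; apply: Js; split=> //; apply: kerU_le x2.
have nJb : ~ J2 (cy b).
  have [x [Fx x0]] := nontrivial nJs0.
  move=> /(_ x); apply: contra_not x0; apply; split=> //.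
  by case: Fx => [[]].
have [|||t0 [nJt0 t0min]] := @chain_le (M p) (fun t => ~ J2 t) F2.
- by exists (cy b).
- by move=> *; apply: sF2.
- by move=> i j x ij [x1 x2]; split=> //; apply: kerU_le x2.
have [m' [Fm' m'0]] := nontrivial nJt0.
pose E q (x : M q) := (forall s, ~ J1 s -> kerR s x) /\ (forall t, ~ J2 t -> kerU t x).
have sE q : subsp (@E q).
  split; first by split=> s _; [case: (subsp_kerR q s)|case: (subsp_kerU q s)].
  move=> a x y [x1 x2] [y1 y2]; split=> s nJ.
    by case: (subsp_kerR q s) => _; apply; [exact: x1|exact: y1].
  by case: (subsp_kerU q s) => _; apply; [exact: x2|exact: y2].
have mE q r (x : M q) : ple q r -> E q x -> E r (mv q r x).
  by move=> qr [x1 x2]; split=> s nJ; [apply/kerR_mv/x1|apply/kerU_mv/x2].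
pose D q := J1 (cx q) /\ J2 (cy q).
have Dp : D p.
  split=> x.
    by move=> [_ /(_ p (ple_refl p) (Rle_refl _))]; rewrite mv_id.
  by move=> [_ /(_ p (ple_refl p) (Rle_refl _))]; rewrite mv_id.
have Em' : E p m'.
  by split=> s nJ; [case: (s0min s nJ m' Fm'.1)|case: (t0min s nJ m' Fm')].
have lt1 s t : J1 s -> ~ J1 t -> s <r t.
  by move=> Js nJt; apply: Rnot_le_lt => ts; apply: nJt; apply: dJ1 Js.
have lt2 s t : J2 s -> ~ J2 t -> s <r t.
  by move=> Js nJt; apply: Rnot_le_lt => ts; apply: nJt; apply: dJ2 Js.
have injR (x : M p) r : E p x -> J1 (cx r) -> ple p r -> cy r = cy p -> mv p r x = 0 -> x = 0.
  move=> [x1 x2] Jr pr ry x0; apply: (Jr); split; last exact: kerR_pt x0.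
  by split; [apply: x1|apply: x2].
have injU (x : M p) r : E p x -> J2 (cy r) -> ple p r -> cx r = cx p -> mv p r x = 0 -> x = 0.
  move=> [x1 x2] Jr pr rx x0; apply: (Jr); split; last exact: kerU_pt x0.
  split; last exact: x1.
  by split; [apply: x1|apply: x2].
(* Lift [e] down to the row of [r], with value zero at [z2] in column [sg], then left to [r], with
   value zero at [z1] in row [ta]. Minimality of the kernels for [sg] and [ta] at [r] puts the
   result in [E r]. *)
have surj r w (e : M w) : D w -> ple r w -> E w e -> exists e' : M r, E r e' /\ mv r w e' = e.
  move=> [Jw1 Jw2] rw [e1 e2].
  have [|||sg [nJsg sgmin]] := @chain_le (M r) (fun s => ~ J1 s) (@kerR r).
  - by exists (cx c).
  - by move=> *; exact: subsp_kerR.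
  - by move=> i j x; exact: kerR_le.
  have [|||ta [nJta tamin]] := @chain_le (M r) (fun t => ~ J2 t) (@kerU r).
  - by exists (cy b).
  - by move=> *; exact: subsp_kerU.
  - by move=> i j x; exact: kerU_le.
  have wsg := lt1 _ _ Jw1 nJsg; have wta := lt2 _ _ Jw2 nJta.
  have [||w1 [w1x w1y]] := @up_pt P r (cx w) (cy r); try coord.
  have [||z2 [z2x z2y]] := @up_pt P r sg (cy r); try coord.
  have [||z1 [z1x z1y]] := @up_pt P r (cx r) ta; try coord.
  have [|||f [fw fz]] := @meet_lift _ _ M ex w1 w z2 _ _ e 0.
  - by rewrite w1x z2x; coord.
  - by rewrite w1y z2y; coord.
  - move=> u wu zu; rewrite linear0; apply: (e1 sg) => //; coord.
  have w1w : ple w1 w by coord.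
  have [|||g [gw gz]] := @meet_lift _ _ M ex r w1 z1 _ _ f 0.
  - by rewrite w1x z1x; coord.
  - by rewrite w1y z1y; coord.
  - move=> u wu zu; have wu' : ple w u by coord.
    rewrite linear0 -(mv_comp w1w wu') fw; apply: (e2 ta) => //; coord.
  have rw1 : ple r w1 by coord.
  have w1z2 : ple w1 z2 by coord.
  have rz1 : ple r z1 by coord.
  exists g; split; last by rewrite -fw -gw mv_comp.
  split=> s nJ.
    apply: (sgmin s nJ) => u ru su; have zu : ple z2 u by coord.
    rewrite -(mv_comp rw1 (ple_trans w1z2 zu)) gw -(mv_comp w1z2 zu) fz linear0 //.
  apply: (tamin s nJ) => u ru su; have zu : ple z1 u by coord.
  by rewrite -(mv_comp rz1 zu) gz linear0.
have lE : lifting D E.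
  move=> r s t Dr [Js1 Js2] [Jt1 Jt2] rs rt a a' [a1 a2] [a1' a2'] aa'.
  have [||z [zx zy]] := @up_pt P r (Rmin (cx s) (cx t)) (Rmin (cy s) (cy t)); try coord.
  have [rz zs zt] : [/\ ple r z, ple z s & ple z t] by split; coord.
  have [e [es et]] := meet_lift ex zx zy aa'.
  have Ee : E z e.
    (* A point above the meet whose column is outside [J1] is to the right of both [s] and [t],
       hence above one of them, and there the given vectors die. Rows are symmetric. *)
    split=> u nJ w zw uw.
      have us := lt1 _ _ Js1 nJ; have ut := lt1 _ _ Jt1 nJ.
      have [sw|tw] : ple s w \/ ple t w by coord.
        by rewrite -(mv_comp zs sw) es; apply: (a1 u).
      by rewrite -(mv_comp zt tw) et; apply: (a1' u).
    have us := lt2 _ _ Js2 nJ; have ut := lt2 _ _ Jt2 nJ.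
    have [sw|tw] : ple s w \/ ple t w by coord.
      by rewrite -(mv_comp zs sw) es; apply: (a2 u).
    by rewrite -(mv_comp zt tw) et; apply: (a2' u).
  have Dz : D z by split; [apply: dJ1 Js1|apply: dJ2 Js2]; coord.
  have [f [Ef fz]] := surj r z e Dz rz Ee.
  by exists f; rewrite -es -et -fz !mv_comp.
have joinD q r : D q -> D r -> D (join q r).
  rewrite /D cx_join cy_join => -[q1 q2] [r1 r2].
  by split; unfold Rmax; destruct Rle_dec.
(* If [m'] died at [r], the values [mv p b' m'] and zero would lift to some [w] in [E p]. Horizontal
   injectivity gives [w = 0], so [m'] dies at [b'], against vertical injectivity. *)
have nz r : D r -> ple p r -> mv p r m' <> 0.
  move=> Dr pr m'r.
  have [||b' [b'x b'y]] := @up_pt P p (cx p) (cy r); try coord.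
  have [||c' [c'x c'y]] := @up_pt P p (cx r) (cy p); try coord.
  have [pb' pc'] : ple p b' /\ ple p c' by coord.
  have Db' : D b' by split; rewrite ?b'x ?b'y; [case: Dp|case: Dr].
  have Dc' : D c' by split; rewrite ?c'x ?c'y; [case: Dr|case: Dp].
  have [|||w [Ew wb wc]] := lE p b' c' Dp Db' Dc' pb' pc' (mv p b' m') 0.
  - exact: mE.
  - by case: (sE c').
  - move=> u bu cu; have ru : ple r u by coord.
    by rewrite linear0 mv_comp // -(mv_comp pr ru) m'r linear0.
  have w0 : w = 0 by apply: (injR w c') => //; case: Dc'.
  apply: m'0; apply: (injU m' b') => //; first by case: Db'.
  by rewrite -wb w0 linear0.
have [||v [vE vD vp]] := @compatible_section _ _ M D _ joinD E p m' sE _ lE Dp Em' nz.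
- by move=> q r s [q1 q2] [s1 s2] qr rs; split; [apply: dJ1 s1|apply: dJ2 s2]; coord.
- by move=> q r _ _ qr x; apply: mE.
(* No map enters the down-set [D] from outside, so the zero submodule serves as [Z]. *)
apply: (@split_off _ _ M (fun z => J1 z.1 /\ J2 z.2) v (fun q x => x = 0)).
- left; exists J1, J2; split; first by exists (cx p); case: Dp.
  split; first by exists (cy p); case: Dp.
  by split.
- by exists p.
- by move=> q r Dq Dr; exists (join q r); split=> //; apply: joinD.
- exact: vD.
- move=> q r Dq /= nDr qr; have [v1 v2] := vE q Dq.
  have [J1r|nJ1r] := pselect (J1 (cx r)).
    apply: (v2 (cy r)) => //; last exact: Rle_refl.
    by move=> J2r; apply: nDr.
  by apply: (v1 (cx r)) => //; exact: Rle_refl.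
- by move=> r; split=> // a x y -> ->; rewrite scaler0 addr0.
- by move=> q r _ _ _ x ->; rewrite linear0.
- move=> q r /= nDq [Dr1 Dr2] qr; case: nDq.
  by split; [apply: dJ1 Dr1|apply: dJ2 Dr2]; case: qr.
- move=> r Dr v0; have Dj := joinD r p Dr Dp.
  apply: (nz (join r p)) => //.
  by rewrite -vp (vD _ _ Dp Dj) // -(vD _ _ Dr Dj) // v0 linear0.
Qed.

End Blocks.

(** * Vertical blocks and birth blocks *)

Section Strips.
Variables (k : fieldType) (P : plane) (M : pmodule k P).
Implicit Types (p q r : P).
Local Notation mv := (mv M).
Hypothesis ex : mexact M.

(** By the first hypothesis no nonzero vector dies both ways, so vertical maps are injective on [E];
    lifting against zero far to the right makes them surjective. [Jp] bounds the strip on the right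
    and [Jm] on the left. *)
Lemma vertical_block p c (m : M p) :
  (forall q b' c' (x : M q), ple q b' -> cx b' = cx q -> ple q c' -> cy c' = cy q ->
     mv q b' x = 0 -> mv q c' x = 0 -> x = 0) ->
  ple p c -> cy c = cy p -> m <> 0 -> mv p c m = 0 -> inhabited (summand M).
Proof.
move=> N1 pc cy_ m0 mc.
pose Jp s := forall x : M p, kerR s x -> x = 0.
have dJp : down_closed Jp.
  by move=> s t ts Js x hx; apply: Js; apply: kerR_le hx.
have nJc : ~ Jp (cx c).
  by move=> /(_ m); apply: contra_not m0; apply; apply: kerR_pt mc.
have ltp s t : Jp s -> ~ Jp t -> s <r t.
  by move=> Js nJt; apply: Rnot_le_lt => ts; apply: nJt; apply: dJp Js.
pose E q (x : M q) := forall s, ~ Jp s -> kerR s x.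
have sE q : subsp (@E q).
  split; first by move=> s _; case: (subsp_kerR M q s).
  by move=> a x y hx hy s nJ; case: (subsp_kerR M q s) => _; apply; [exact: hx|exact: hy].
have mE q r (x : M q) : ple q r -> E q x -> E r (mv q r x).
  by move=> qr hx s nJ; apply/kerR_mv/hx.
have vinj q q' (x : M q) : ple q q' -> cx q' = cx q -> E q x -> mv q q' x = 0 -> x = 0.
  move=> qq' qx Ex x0.
  have [||c' [c'x c'y]] := @up_pt P q (Rmax (cx q) (cx c)) (cy q); try coord.
  by apply: (N1 q q' c') => //; [coord|apply: (Ex (cx c)) => //; coord].
have vinj2 q q' (x y : M q) : ple q q' -> cx q' = cx q -> E q x -> E q y ->
    mv q q' x = mv q q' y -> x = y.
  move=> qq' qx Ex Ey xy; apply/eqP; rewrite -subr_eq0; apply/eqP.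
  by apply: (vinj q q') => //; [exact: (subspB (sE q))|rewrite linearB xy subrr].
have vsurj q q' (x : M q') : ple q q' -> cx q' = cx q -> E q' x ->
    exists y : M q, E q y /\ mv q q' y = x.
  move=> qq' qx Ex.
  have [|||sg [nJsg sgmin]] := @chain_le k (M q) (fun s => ~ Jp s) (@kerR _ _ M q).
  - by exists (cx c).
  - by move=> *; exact: subsp_kerR.
  - by move=> i j y; exact: kerR_le.
  have [||z [zx zy]] := @up_pt P q (Rmax (cx q) sg) (cy q); try coord.
  have [|||y [yq yz]] := @meet_lift _ _ M ex q q' z _ _ x 0.
  - by rewrite zx; coord.
  - by rewrite zy; coord.
  - by move=> u qu zu; rewrite linear0; apply: (Ex sg) => //; coord.
  have qz : ple q z by coord.
  exists y; split=> // s nJ; apply: (sgmin s nJ) => u qu su.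
  have zu : ple z u by coord.
  by rewrite -(mv_comp qz zu) yz linear0.
have injp (x : M p) r : E p x -> ple p r -> Jp (cx r) -> mv p r x = 0 -> x = 0.
  move=> Ex pr Jr x0.
  have [||c' [c'x c'y]] := @up_pt P p (cx r) (cy p); try coord.
  have [pc' c'r] : ple p c' /\ ple c' r by coord.
  apply: (Jr); rewrite -c'x; apply: kerR_pt => //.
  by apply: (vinj c' r) => //; [exact: mE|rewrite mv_comp].
(* [G q u]: the vectors of [E q] that come from column [u]. *)
pose G q u (x : M q) := E q x /\ exists r (n : M r), [/\ cx r <=r u, E r n & agree n x].
have Gle q i j (x : M q) : i <=r j -> G q i x -> G q j x.
  move=> ij [Ex [r [n [ri En nx]]]]; split=> //; exists r, n; split=> //; lra.
pose Jm u := exists x : M p, G p u x /\ x <> 0.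
have uJm : up_closed Jm.
  by move=> s t st [x [Gx x0]]; exists x; split=> //; apply: Gle Gx.
have sG q u : Jm u -> subsp (G q u).
  move=> [x0 [[_ [r0 [_ [r0u _ _]]]] _]]; split.
    split; first by case: (sE q).
    exists r0, 0; split=> //; first by case: (sE r0).
    by move=> *; rewrite !linear0.
  move=> a x y [Ex [r [n [ru En nx]]]] [Ey [r' [n' [ru' En' nx']]]]; split.
    by case: (sE q) => _; apply.
  exists (join r r'), (a *: mv r (join r r') n + mv r' (join r r') n'); split.
  - by coord.
  - by case: (sE (join r r')) => _; apply; apply: mE.
  - apply: agree_lin => u' ju qu; rewrite mv_comp //; [apply: nx|apply: nx'] => //.
      by apply: ple_trans ju.
    by apply: ple_trans ju.
have mG q r u (x : M q) : ple q r -> G q u x -> G r u (mv q r x).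
  move=> qr [Ex [s [n [su En nx]]]]; split; first exact: mE.
  exists s, n; split=> // w sw rw; rewrite mv_comp //; apply: nx => //; exact: ple_trans rw.
have [|||s0 [nJs0 s0min]] := @chain_le k (M p) (fun s => ~ Jp s) (@kerR _ _ M p).
- by exists (cx c).
- by move=> *; exact: subsp_kerR.
- by move=> i j y; exact: kerR_le.
have Jmp : Jm (cx p).
  have [x [Kx x0]] := nontrivial nJs0; have Ex : E p x by move=> s nJ; apply: s0min.
  exists x; split=> //; split=> //; exists p, x; split=> //; exact: Rle_refl.
have Jpp : Jp (cx p).
  by move=> x /(_ p (ple_refl p) (Rle_refl _)); rewrite mv_id.
have [|||u0 [Ju0 u0min]] := @chain_le k (M p) Jm (@G p).
- by exists (cx p).
- exact: sG.
- by move=> i j y; exact: Gle.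
have [m' [Gm' m'0]] := Ju0.
have Em' : E p m' by case: Gm'.
pose D q := Jp (cx q) /\ Jm (cx q).
have Dp : D p by [].
pose X0 q (x : M q) := E q x /\ forall u, Jm u -> G q u x.
have sX0 q : subsp (@X0 q).
  split; first by split=> [|u Ju]; [case: (sE q)|case: (sG q u Ju)].
  move=> a x y [Ex hx] [Ey hy]; split; first by case: (sE q) => _; apply.
  by move=> u Ju; case: (sG q u Ju) => _; apply; [exact: hx|exact: hy].
have surj r s (x : M s) : D r -> ple r s -> X0 s x -> exists e : M r, X0 r e /\ mv r s e = x.
  move=> [Jpr Jmr] rs [Ex hx].
  (* Take a source of [x] in a column so far left that [G r us] is smallest and not beyond [r]; move
     it to the column of [r], then down to [r]. *)
  have [|||us [Jus usmin]] := @chain_le k (M r) Jm (@G r).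
  - by exists (cx p).
  - exact: sG.
  - by move=> i j y; exact: Gle.
  have Jum : Jm (Rmin us (cx r)) by unfold Rmin; destruct Rle_dec.
  have [_ [r' [n [r'u En nx]]]] := hx _ Jum.
  have jx : cx (join r' r) = cx r by coord.
  have [e [Ee ej]] := vsurj r (join r' r) (mv r' (join r' r) n) (ple_joinr _ _) jx (mE _ _ _ (ple_joinl _ _) En).
  have ne : agree n e by apply: agreeP; rewrite ej.
  exists e; split.
    split=> // u Ju; apply: usmin => //; split=> //; exists r', n; split=> //.
    by coord.
  apply: (vinj2 s (join (join r' r) s)) => //; first by coord.
    exact: mE.
  have rw : ple r (join (join r' r) s) by coord.
  have r'w : ple r' (join (join r' r) s) by coord.
  by rewrite mv_comp // -ne // nx.
have lX0 : lifting D X0.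
  move=> r s t Dr Ds Dt rs rt a b Xa Xb ab.
  (* Only the vector in the left column is lifted; the other equation follows from injectivity along
     columns. *)
  have [st|st] := Rle_dec (cx s) (cx t).
    have [e [Xe es]] := surj r s a Dr rs Xa; exists e; split=> //.
    apply: (vinj2 t (join s t)) => //; first by coord.
    + by case: Xe => Ee _; apply: mE.
    + by case: Xb.
    by rewrite mv_comp // -(mv_comp rs (ple_joinl s t)) es ab.
  have [e [Xe et]] := surj r t b Dr rt Xb; exists e; split=> //.
  apply: (vinj2 s (join s t)) => //; first by coord.
  + by case: Xe => Ee _; apply: mE.
  + by case: Xa.
  by rewrite mv_comp // -(mv_comp rt (ple_joinr s t)) et ab.
have joinD q r : D q -> D r -> D (join q r).
  by rewrite /D cx_join => -[q1 q2] [r1 r2]; split; unfold Rmax; destruct Rle_dec.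
have nz r : D r -> ple p r -> mv p r m' <> 0.
  by move=> [Jr _] pr m'r; apply: m'0; apply: injp m'r.
have [|||v [vX vD vp]] := @compatible_section _ _ M D _ joinD X0 p m' sX0 _ lX0 Dp _ nz.
- by move=> q r s [q1 q2] [s1 s2] qr rs; split; [apply: dJp s1|apply: uJm q2]; coord.
- move=> q r _ _ qr x [Ex hx]; split; first exact: mE.
  by move=> u Ju; apply/mG/hx.
- by split=> // u Ju; apply: u0min.
have vnz r : D r -> v r <> 0.
  move=> Dr v0; have Dj := joinD r p Dr Dp; apply: (nz (join r p)) => //.
  by rewrite -vp (vD _ _ Dp Dj) // -(vD _ _ Dr Dj) // v0 linear0.
(* Here [Z] collects the images from columns to the left of the strip; zero is listed apart since
   there may be no such column. *)
apply: (@split_off _ _ M (fun z => Jp z.1 /\ Jm z.1) v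
  (fun r x => x = 0 \/ exists q (n : M q), [/\ ple q r, ~ Jm (cx q) & mv q r n = x])).
- right; right; left; exists (fun s => Jp s /\ Jm s); split; first by exists (cx p).
  split=> // s t u st tu [s1 s2] [u1 u2]; split; [exact: dJp u1|exact: uJm s2].
- by exists p.
- by move=> q r Dq Dr; exists (join q r); split=> //; apply: joinD.
- exact: vD.
- move=> q r Dq /= nDr qr; have [Ev _] := vX q Dq.
  apply: (Ev (cx r)) => //; last exact: Rle_refl.
  by move=> Jpr; apply: nDr; split=> //; apply: uJm Dq.2; case: qr.
- move=> r; split; first by left.
  move=> a x y [->|[q [n [qr nq nx]]]]; first by rewrite scaler0 add0r.
  move=> [->|[q' [n' [qr' nq' nx']]]]; right.
    by rewrite addr0; exists q, (a *: n); split=> //; rewrite linearZ_LR nx.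
  exists (join q q'), (a *: mv q (join q q') n + mv q' (join q q') n'); split.
  + exact: join_ple.
  + by rewrite cx_join; unfold Rmax; destruct Rle_dec.
  + by rewrite linearD linearZ_LR !mv_comp ?nx ?nx' //; apply: join_ple.
- move=> q r Dq Dr qr x [->|[q' [n [qr' nq nx]]]]; first by left; rewrite linear0.
  right; exists q', n; split=> //; first exact: ple_trans qr.
  by rewrite -nx mv_comp.
- move=> q r /= nDq [Dr1 Dr2] qr x; right; exists q, x; split=> //.
  by move=> Jq; apply: nDq; split=> //; apply: dJp Dr1; case: qr.
- move=> r Dr /= [|[q [n [qr nq nx]]]]; first exact: vnz.
  have qp : cx q <r cx p.
    by apply: Rnot_le_lt => pq; apply: nq; apply: uJm Jmp.
  (* If [v r] came from [q], its preimage [n'] in the row of [r] would belong to [E] and agree with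
     [m'], putting [cx q] into [Jm]. *)
  have [||q' [q'x q'y]] := @up_pt P q (cx q) (cy r); try coord.
  have [qq' q'r] : ple q q' /\ ple q' r by coord.
  pose n' := mv q q' n; have n'r : mv q' r n' = v r by rewrite mv_comp.
  have En' : E q' n'.
    move=> s nJ u qu su; have rs : cx r <r s := ltp _ _ Dr.1 nJ; have ru : ple r u by coord.
    by rewrite -(mv_comp q'r ru) n'r; apply: ((vX r Dr).1 s).
  apply: nq; rewrite -q'x; exists m'; split=> //; split=> //.
  exists q', n'; split=> //; first exact: Rle_refl.
  apply: agreeP; set w := join q' p.
  have [q'w pw] : ple q' w /\ ple p w by rewrite /w.
  have wx : cx w = cx p by rewrite /w; coord.
  (* The difference comes from some [d0] in [E p] that dies at [u], where both vectors become [v u];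
     hence [d0 = 0]. *)
  set d := mv q' w n' - mv p w m'.
  have [d0 [Ed0 dE]] : exists d0, E p d0 /\ mv p w d0 = d.
    by apply: vsurj => //; apply: (subspB (sE w)); apply: mE.
  pose u := join w r; have [wu ru] : ple w u /\ ple r u by rewrite /u.
  have Du : D u by rewrite /D /u cx_join wx; have [] := joinD p r Dp Dr; rewrite cx_join.
  have d00 : d0 = 0.
    apply: (injp d0 u) => //; [exact: ple_trans wu|by case: Du|].
    rewrite -(mv_comp pw wu) dE linearB (mv_comp q'w wu) (mv_comp pw wu).
    rewrite -(mv_comp q'r ru) n'r (vD _ _ Dr Du ru) -vp (vD _ _ Dp Du) ?subrr //.
    exact: ple_trans wu.
  by apply/eqP; rewrite -subr_eq0 -/d -dE d00 linear0.
Qed.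

(** With injective maps, [agree] is transitive and plays the role of equality in the colimit, which
    is never built. [V x] and [H y] are the filtrations of the colimit by columns and rows, read at
    a point. *)
Lemma birth_block p (m : M p) :
  (forall q r (x : M q), ple q r -> mv q r x = 0 -> x = 0) -> m <> 0 -> inhabited (summand M).
Proof.
move=> inj0 m0.
have inj q r (x y : M q) : ple q r -> mv q r x = mv q r y -> x = y.
  move=> qr xy; apply/eqP; rewrite -subr_eq0; apply/eqP/(inj0 q r) => //.
  by rewrite linearB xy subrr.
have agree_trans q r s (x : M q) (y : M r) (z : M s) : agree x y -> agree y z -> agree x z.
  move=> xy yz u qu su; have [uj rj] : ple u (join u r) /\ ple r (join u r) by [].
  apply: (inj u (join u r)) => //; rewrite !mv_comp // xy ?yz //; exact: ple_trans uj.
pose V x q (a : M q) := exists r (n : M r), cx r <=r x /\ agree n a.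
pose H y q (a : M q) := exists r (n : M r), cy r <=r y /\ agree n a.
have agV x q r (a : M q) (b : M r) : agree a b -> V x q a -> V x r b.
  by move=> ab [s [n [sx na]]]; exists s, n; split=> //; apply: agree_trans ab.
have agH x q r (a : M q) (b : M r) : agree a b -> H x q a -> H x r b.
  by move=> ab [s [n [sx na]]]; exists s, n; split=> //; apply: agree_trans ab.
have linV x q : (exists r : P, cx r <=r x) -> subsp (V x q).
  move=> [r0 r0x]; split; first by exists r0, 0; split=> // u _ _; rewrite !linear0.
  move=> a y z [r [n [rx ny]]] [r' [n' [rx' nz]]].
  exists (join r r'), (a *: mv r (join r r') n + mv r' (join r r') n'); split; first by coord.
  apply: agree_lin => u ju qu; rewrite mv_comp //; [apply: ny|apply: nz] => //; by apply: ple_trans ju.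
have linH x q : (exists r : P, cy r <=r x) -> subsp (H x q).
  move=> [r0 r0x]; split; first by exists r0, 0; split=> // u _ _; rewrite !linear0.
  move=> a y z [r [n [rx ny]]] [r' [n' [rx' nz]]].
  exists (join r r'), (a *: mv r (join r r') n + mv r' (join r r') n'); split; first by coord.
  apply: agree_lin => u ju qu; rewrite mv_comp //; [apply: ny|apply: nz] => //; by apply: ple_trans ju.
have Vle i j q (x : M q) : i <=r j -> V i q x -> V j q x.
  by move=> ij [r [n [ri nx]]]; exists r, n; split=> //; lra.
have Hle i j q (x : M q) : i <=r j -> H i q x -> H j q x.
  by move=> ij [r [n [ri nx]]]; exists r, n; split=> //; lra.
have Vself q (x : M q) : V (cx q) q x by exists q, x; split=> //; exact: Rle_refl.
have Hself q (x : M q) : H (cy q) q x by exists q, x; split=> //; exact: Rle_refl.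
(* [t] is the meet of [join r1 t], in its column, and [join r2 t], in its row. *)
have VH q t (x : M q) : V (cx t) q x -> H (cy t) q x -> exists n : M t, agree n x.
  move=> [r1 [n1 [r1x n1x]]] [r2 [n2 [r2y n2x]]].
  have n1j := agree_mv n1 (ple_joinl r1 t); have n2j := agree_mv n2 (ple_joinl r2 t).
  have [|||w [w1 w2]] := @meet_lift _ _ M ex t (join r1 t) (join r2 t) _ _
    (mv r1 (join r1 t) n1) (mv r2 (join r2 t) n2).
  - by rewrite !cx_join; coord.
  - by rewrite !cy_join; coord.
  - apply: (agree_trans _ _ _ _ _ _ (agree_sym n1j)); apply: (agree_trans _ _ _ _ _ _ n1x).
    exact: (agree_trans _ _ _ _ _ _ (agree_sym n2x)).
  exists w; apply: (agree_trans _ _ _ _ _ _ _ n1x); apply: (agree_trans _ _ _ _ _ _ _ (agree_sym n1j)).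
  by rewrite -w1; apply: agree_mv.
pose J1 x := exists a, V x p a /\ a <> 0.
have uJ1 : up_closed J1 by move=> s t st [a [Va a0]]; exists a; split=> //; apply: Vle Va.
have J1p : J1 (cx p) by exists m.
have [|||x0 [Jx0 x0min]] := @chain_le k (M p) J1 (fun x => V x p).
- by exists (cx p).
- by move=> x [a [[r [n [rx _]]] _]]; apply: linV; exists r.
- by move=> *; apply: Vle; eassumption.
pose J2 y := exists a, (V x0 p a /\ H y p a) /\ a <> 0.
have uJ2 : up_closed J2.
  by move=> s t st [a [[Va Ha] a0]]; exists a; do 2!split=> //; apply: Hle Ha.
have J2p : J2 (cy p) by have [a [Va a0]] := Jx0; exists a.
have sV0 : subsp (V x0 p) by have [a [[r [n [rx _]]] _]] := Jx0; apply: linV; exists r.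
have [|||y0 [Jy0 y0min]] := @chain_le k (M p) J2 (fun y a => V x0 p a /\ H y p a).
- by exists (cy p).
- by move=> x [a [[_ [r [n [rx _]]]] _]]; apply: subspI => //; apply: linH; exists r.
- by move=> i j x ij [? ?]; split=> //; apply: Hle; eassumption.
have [m' [[Vm' Hm'] m'0]] := Jy0.
have lt1 s t : ~ J1 s -> J1 t -> s <r t.
  by move=> ns Jt; apply: Rnot_le_lt => ts; apply: ns; apply: uJ1 Jt.
have lt2 s t : ~ J2 s -> J2 t -> s <r t.
  by move=> ns Jt; apply: Rnot_le_lt => ts; apply: ns; apply: uJ2 Jt.
pose D q := J1 (cx q) /\ J2 (cy q).
have line q : D q -> exists n : M q, agree n m'.
  move=> [Jq1 Jq2]; apply: VH; first exact: x0min.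
  by case: (y0min _ Jq2 m').
pose v q : M q := if pselect (D q) is left Dq then projT1 (cid (line q Dq)) else 0.
have vm q : D q -> agree (v q) m'.
  by move=> Dq; rewrite /v; case: pselect => // Dq'; case: cid.
(* [V x] is empty, not zero, when no point has column at most [x]; so zero is added by hand. *)
pose nV r (a : M r) := a = 0 \/ exists x, ~ J1 x /\ V x r a.
pose nH r (a : M r) := a = 0 \/ exists x, ~ J2 x /\ H x r a.
have snV r : subsp (@nV r).
  split; first by left.
  move=> c a b [->|[x [nx Va]]]; first by rewrite scaler0 add0r.
  have ex_ y : V y r a -> exists r : P, cx r <=r y by move=> [s [n [sy _]]]; exists s.
  move=> [->|[y [ny Vb]]]; right.
    by exists x; split=> //; rewrite addr0; apply: (subspZ _ (linV x r (ex_ x Va))).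
  have [xy|xy] := Rle_dec x y.
    have Va' := Vle _ _ _ _ xy Va.
    by exists y; split=> //; have [_] := linV y r (ex_ y Va'); apply.
  exists x; split=> //; have [_] := linV x r (ex_ x Va); apply=> //.
  apply: Vle Vb; lra.
have snH r : subsp (@nH r).
  split; first by left.
  move=> c a b [->|[x [nx Va]]]; first by rewrite scaler0 add0r.
  have ex_ y : H y r a -> exists r : P, cy r <=r y by move=> [s [n [sy _]]]; exists s.
  move=> [->|[y [ny Vb]]]; right.
    by exists x; split=> //; rewrite addr0; apply: (subspZ _ (linH x r (ex_ x Va))).
  have [xy|xy] := Rle_dec x y.
    have Va' := Hle _ _ _ _ xy Va.
    by exists y; split=> //; have [_] := linH y r (ex_ y Va'); apply.
  exists x; split=> //; have [_] := linH x r (ex_ x Va); apply=> //.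
  apply: Hle Vb; lra.
have mnV q r (a : M q) : ple q r -> nV q a -> nV r (mv q r a).
  move=> qr [->|[x [nx Va]]]; first by left; rewrite linear0.
  by right; exists x; split=> //; apply: agV Va; apply: agree_mv.
have mnH q r (a : M q) : ple q r -> nH q a -> nH r (mv q r a).
  move=> qr [->|[x [nx Va]]]; first by left; rewrite linear0.
  by right; exists x; split=> //; apply: agH Va; apply: agree_mv.
apply: (@split_off _ _ M (fun z => J1 z.1 /\ J2 z.2) v
  (fun r z => exists a b, [/\ nV r a, nH r b & z = a + b])).
- right; left; exists J1, J2; split; first by exists (cx p).
  by split; first by exists (cy p).
- by exists p.
- move=> q r [q1 q2] [r1 r2]; exists (join q r); split=> //=.
  by split; [apply: uJ1 q1|apply: uJ2 q2] => /=; coord.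
- move=> q r Dq Dr qr; apply: agree_le => //.
  exact: (agree_trans _ _ _ _ _ _ (vm q Dq) (agree_sym (vm r Dr))).
- move=> q r [q1 q2] /= nDr qr; case: nDr.
  by split; [apply: uJ1 q1|apply: uJ2 q2] => /=; coord.
- move=> r; split; first by exists 0, 0; split; [left|left|rewrite addr0].
  move=> c _ _ [a [b [Va Hb ->]]] [a' [b' [Va' Hb' ->]]].
  exists (c *: a + a'), (c *: b + b'); split; last by rewrite scalerDr addrACA.
    by case: (snV r) => _; apply.
  by case: (snH r) => _; apply.
- move=> q r _ _ qr _ [a [b [Va Hb ->]]]; exists (mv q r a), (mv q r b).
  by split; [exact: mnV|exact: mnH|rewrite linearD].
- move=> q r /= nDq Dr qr x.
  (* A map entering [D] starts outside [J2] or outside [J1], so its image lies in [nH] or in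
     [nV]. *)
  have [Jq|nJq] := pselect (J1 (cx q)).
    exists 0, (mv q r x); split; [by left| |by rewrite add0r].
    right; exists (cy q); split; first by move=> J; apply: nDq.
    exact: (agH _ _ _ _ _ (agree_mv x qr)).
  exists (mv q r x), 0; split; [|by left|by rewrite addr0].
  right; exists (cx q); split=> //.
  exact: (agV _ _ _ _ _ (agree_mv x qr)).
- move=> r Dr [a [b [Va Hb vab]]].
  have [rs ps] : ple r (join r p) /\ ple p (join r p) by [].
  set s := join r p in rs ps.
  have {}vab : mv p s m' = mv r s a + mv r s b by rewrite -(vm r Dr) // vab linearD.
  have {}Va := mnV _ _ _ rs Va; have {}Hb := mnH _ _ _ rs Hb.
  move: (mv r s a) (mv r s b) vab Va Hb => {}a {}b vab Va Hb.
  have pm := agree_mv m' ps.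
  have sH : subsp (H (cy p) s) by apply: linH; exists p; exact: Rle_refl.
  (* Being [m' - b], the vector [a] lies in [H (cy p)] as well as in [V x], so it comes from [p]. As
     [x] is outside [J1], it vanishes. *)
  have a0 : a = 0.
    case: Va => // -[x [nx Va]].
    have Ha : H (cy p) s a.
      have -> : a = mv p s m' - b by rewrite vab addrK.
      apply: (subspB sH); first exact: agH pm (Hself _ _).
      case: Hb => [->|[y [ny Hb]]]; first by case: sH.
      by apply: Hle Hb; apply/Rlt_le/lt2.
    have [|a' a'a] := VH s p a _ Ha.
      by apply: Vle Va; apply/Rlt_le/lt1.
    have a'0 : a' = 0.
      apply: contrapT => a'0; apply: nx; exists a'; split=> //.
      by apply: agV Va; apply: agree_sym.
    by rewrite -(agree_le ps a'a) a'0 linear0.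
  rewrite a0 add0r in vab.
  (* Now [m'] agrees with [b], which comes from a row [y] outside [J2]; but [m'] is a nonzero vector
     of [V x0]. *)
  have b0 : b <> 0 by rewrite -vab => /inj0 h; apply: m'0; apply: h.
  case: Hb => [//|[y [ny Hb]]]; apply: ny; exists m'; do 2!split=> //.
  by apply: agH Hb; rewrite -vab; apply: agree_sym.
Qed.

End Strips.

(** * Exchanging the coordinates *)

Section Swap.
Variables (k : fieldType) (P : plane) (M : pmodule k P).

(** The points stay and only the coordinate functions are exchanged, so modules keep their spaces
    and maps. *)
Definition swap_plane : plane := @Plane P cy cx
  (fun p x y hx hy => let: exist q (conj qx qy) := up_pt hy hx in exist _ q (conj qy qx)).

Definition swap_pmodule : pmodule k swap_plane :=
  @PModule k swap_plane M (mv M) (@mv_id _ _ M)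
    (fun p q r pq qr => @mv_comp _ _ M p q r (conj (proj2 pq) (proj1 pq)) (conj (proj2 qr) (proj1 qr))).

Lemma swap_mexact : mexact M -> mexact swap_pmodule.
Proof.
move=> ex a b c d bx cy_ dx dy [ab1 ab2] [ac1 ac2] u v uv.
have [|||||||w [wc wb]] := ex a c b d _ _ _ _ _ _ v u; rewrite //; by exists w.
Qed.

Lemma swap_block (J : pt2 -> Prop) : is_block J -> is_block (fun z => J (z.2, z.1)).
Proof.
move=> [[J1 [J2 [n1 [n2 [d1 [d2 JE]]]]]]|[[J1 [J2 [n1 [n2 [d1 [d2 JE]]]]]]|[[J1 [n1 [c1 JE]]]|[J1 [n1 [c1 JE]]]]]].
- left; exists J2, J1; repeat (split; first assumption); move=> z; have /= := JE (z.2, z.1); tauto.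
- right; left; exists J2, J1; repeat (split; first assumption); move=> z; have /= := JE (z.2, z.1); tauto.
- right; right; right; exists J1; repeat (split; first assumption); move=> z; have /= := JE (z.2, z.1); tauto.
- right; right; left; exists J1; repeat (split; first assumption); move=> z; have /= := JE (z.2, z.1); tauto.
Qed.

Lemma swap_summand : summand swap_pmodule -> summand M.
Proof.
case=> B v phi blB Bp vout vmv lin pout pmv pv.
apply: (@Summand _ _ M (fun z => B (z.2, z.1)) v phi) => //.
- exact: swap_block.
- by move=> q r Bq [q1 q2]; exact: (vmv q r Bq (conj q2 q1)).
- by move=> q r x Br [q1 q2]; exact: (pmv q r x Br (conj q2 q1)).
Qed.

End Swap.

(** * Decomposition *)

HB.instance Definition _ (k : fieldType) (P : plane) (M : pmodule k P) :=
  gen_eqMixin (summand M).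

Section Decomposition.
Variables (k : fieldType) (P : plane).

(** If there were no summand, each block lemma would become an injectivity statement: nothing dies
    both ways, horizontal maps are injective, then vertical ones by exchange, hence all maps;
    [birth_block] then gives a contradiction. *)
Lemma exists_summand (M : pmodule k P) p (m : M p) : mexact M -> m <> 0 -> inhabited (summand M).
Proof.
move=> ex m0; apply: contrapT => nS.
have N1 q b c (x : M q) : ple q b -> cx b = cx q -> ple q c -> cy c = cy q ->
    mv M q b x = 0 -> mv M q c x = 0 -> x = 0.
  by move=> qb bx qc cy_ xb xc; apply: contrapT => x0; apply: nS; apply: death_block x0 xb xc.
have injR q c (x : M q) : ple q c -> cy c = cy q -> mv M q c x = 0 -> x = 0.
  by move=> qc cy_ xc; apply: contrapT => x0; apply: nS; apply: vertical_block x0 xc.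
have injU q b (x : M q) : ple q b -> cx b = cx q -> mv M q b x = 0 -> x = 0.
  move=> [qb1 qb2] bx xb; apply: contrapT => x0; apply: nS.
  have [||//|//|//|s] := @vertical_block _ _ (swap_pmodule M) (swap_mexact ex) q b x.
  - move=> r b' c' y [rb1 rb2] b'x [rc1 rc2] c'y yb yc.
    exact: (N1 r c' b').
  - by [].
  by constructor; apply: swap_summand.
apply: nS; apply: (birth_block ex _ m0) => q r x qr xr.
have [||c [cx_ cy_]] := @up_pt P q (cx r) (cy q); try coord.
have [qc cr] : ple q c /\ ple c r by coord.
by apply: (injR q c) => //; apply: (injU c r) => //; rewrite mv_comp.
Qed.

Lemma sphi0 (M : pmodule k P) (s : summand M) p : sphi s (0 : M p) = 0.
Proof.
have := sphi_lin s 1 (0 : M p) 0; rewrite scaler0 addr0 mul1r.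
by move=> /eqP; rewrite -subr_eq subrr eq_sym => /eqP.
Qed.

Lemma scalar_span0 (V : vectType k) (f : V -> k) (X : seq V) :
  (forall a x y, f (a *: x + y) = a * f x + f y) -> {in X, forall x, f x = 0} ->
  {in <<X>>%VS, forall x, f x = 0}.
Proof.
move=> lin; elim: X => [|v X IH] fX x.
  rewrite span_nil memv0 => /eqP ->.
  have := lin 1 0 0; rewrite scaler0 addr0 mul1r => /eqP; rewrite -subr_eq subrr eq_sym => /eqP //.
rewrite span_cons => /memv_addP[_ /vlineP[c ->] [y yX ->]].
rewrite lin fX ?mem_head // mulr0 add0r; apply: IH => // z zX.
by apply: fX; rewrite in_cons zX orbT.
Qed.

Lemma scalar_sum (I : eqType) (V : vectType k) (f : V -> k) (v : I -> V) (c : I -> k) l j :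
  (forall a x y, f (a *: x + y) = a * f x + f y) -> uniq l ->
  {in l, forall i, i != j -> f (v i) = 0} ->
  f (\sum_(i <- l) c i *: v i) = if j \in l then c j * f (v j) else 0.
Proof.
move=> lin; elim: l => [|h l IH] /=.
  by rewrite big_nil => _ _; have := lin 1 0 0;
    rewrite scaler0 addr0 mul1r => /eqP; rewrite -subr_eq subrr eq_sym => /eqP.
move=> /andP[hl ul] fv; rewrite big_cons lin IH //; last first.
  by move=> i il; apply: fv; rewrite in_cons il orbT.
rewrite in_cons; have [->|hj] := eqVneq j h; first by rewrite (negPf hl) addr0.
by rewrite fv ?mem_head 1?eq_sym // mulr0 add0r.
Qed.

Variable M : pmodule k P.
Implicit Types (p q : P) (i j : summand M) (S : summand M -> Prop) (l : seq (summand M)).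

Local Notation Bp i p := (sB i (cx p, cy p)).

Definition orthogonal S :=
  forall i j, S i -> S j -> i <> j -> forall p, sphi i (sv j p) = 0.

(** Members of [S] whose block misses [p] are allowed, so that one list can serve two points. *)
Definition full S (p : P) l :=
  [/\ uniq l, forall i, i \in l -> S i & forall i, S i -> Bp i p -> i \in l].

(** The retractions show that the generators alive at [p] are linearly independent, so the dimension
    of [M p] bounds their number. *)
Lemma exists_full S p : orthogonal S -> exists l, full S p l.
Proof.
move=> oS.
pose ok l := [/\ uniq l, forall i, i \in l -> S i & forall i, i \in l -> Bp i p].
have okfree l : ok l -> free [seq sv i p | i <- l].
  elim: l => [|h l IH] [/=]; first by rewrite nil_free.
  move=> /andP[hl ul] lS lB; rewrite free_cons IH ?andbT; last first.
    by split=> // i il; [apply: lS|apply: lB]; rewrite in_cons il orbT.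
  apply/negP => /(scalar_span0 (@sphi_lin _ _ _ h p)) h0.
  have /h0 /eqP : {in [seq sv i p | i <- l], forall x, sphi h x = 0}.
    move=> _ /mapP[i il ->]; apply: oS; [exact/lS/mem_head|by apply: lS; rewrite in_cons il orbT|].
    by move=> hi; rewrite hi il in hl.
  by rewrite sphi_sv ?oner_eq0 //; apply/lB/mem_head.
pose Q n := `[< exists l, ok l /\ size l = n >].
have exQ : exists n, Q n by exists 0%N; apply/asboolP; exists [::].
have ubQ n : Q n -> (n <= \dim (fullv : {vspace M p}))%N.
  move=> /asboolP[l [/okfree + <-]]; rewrite /free size_map => /eqP <-.
  exact/dimvS/subvf.
case: (ex_maxnP exQ ubQ) => n /asboolP[l [[ul lS lB] ln]] nmax.
exists l; split=> // i Si Bi; apply: contrapT => /negP il.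
have: Q n.+1.
  apply/asboolP; exists (i :: l); rewrite /= ln; split=> //; split=> /=.
  - by rewrite il.
  - by move=> j; rewrite in_cons => /orP[/eqP->//|/lS].
  - by move=> j; rewrite in_cons => /orP[/eqP->//|/lB].
by move=> /nmax; rewrite ltnn.
Qed.

(** * The common kernel of an orthogonal family *)

Section Complement.
Variables (S : summand M -> Prop).
Hypothesis oS : orthogonal S.

Definition full_seq p : seq (summand M) := projT1 (cid (exists_full p oS)).

Lemma full_seqP p : full S p (full_seq p).
Proof. by rewrite /full_seq; case: cid. Qed.

Definition compl p (x : M p) := forall i, S i -> sphi i x = 0.

Definition cproj l p (x : M p) := x - \sum_(i <- l) sphi i x *: sv i p.

Lemma cproj_compl l p (x : M p) : full S p l -> compl (cproj l x).
Proof.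
move=> [ul lS lB] j Sj; rewrite /cproj addrC -scaleN1r sphi_lin.
have [Bj|nBj] := pselect (Bp j p); last by rewrite !sphi_out // mulr0 addr0.
rewrite (@scalar_sum _ _ _ _ _ _ j) //; first by rewrite lB // sphi_sv // mulr1 mulN1r addNr.
  exact: sphi_lin.
by move=> i il ij; apply: oS => //; [exact: lS|apply/eqP; rewrite eq_sym].
Qed.

(** Summands whose block misses [p] contribute zero, and full lists share all the others. *)
Lemma cproj_full l l' p (x : M p) : full S p l -> full S p l' -> cproj l x = cproj l' x.
Proof.
move=> [ul lS lB] [ul' lS' lB']; congr (_ - _).
have red l0 : \sum_(i <- l0) sphi i x *: sv i p =
    \sum_(i <- [seq i <- l0 | `[< Bp i p >]]) sphi i x *: sv i p.
  rewrite big_filter [RHS]big_mkcond; apply: eq_bigr => i _.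
  by case: ifP => // /asboolPn nB; rewrite sv_out // scaler0.
rewrite red [RHS]red; apply: perm_big; apply: uniq_perm; rewrite ?filter_uniq // => i.
rewrite !mem_filter; case: asboolP => //= Bi.
by apply/idP/idP => [/lS|/lS'] Si; [exact: lB'|exact: lB].
Qed.

Lemma cproj_id l p (x : M p) : (forall i, i \in l -> S i) -> compl x -> cproj l x = x.
Proof.
move=> lS Cx; rewrite /cproj big_seq big1 ?subr0 // => i /lS Si.
by rewrite Cx // scale0r.
Qed.

Lemma cproj_mv l p q (x : M p) : ple p q -> mv M p q (cproj l x) = cproj l (mv M p q x).
Proof.
move=> pq; rewrite /cproj linearB linear_sum; congr (_ - _); apply: eq_bigr => i _.
rewrite linearZ_LR; have [Bi|nBi] := pselect (Bp i p); have [Bj|nBj] := pselect (Bp i q).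
- by rewrite sv_mv // sphi_mv.
- by rewrite sv_mv // (sv_out nBj) !scaler0.
- by rewrite (sv_out nBi) linear0 scaler0 sphi_mv // sphi_out // scale0r.
- by rewrite (sv_out nBi) (sv_out nBj) linear0 !scaler0.
Qed.

Lemma cproj_sv l p i : full S p l -> S i -> cproj l (sv i p) = 0.
Proof.
move=> [ul lS lB] Si; rewrite /cproj; have [Bi|nBi] := pselect (Bp i p); last first.
  by rewrite (sv_out nBi) big1 ?subr0 // => j _; rewrite sphi0 scale0r.
rewrite (bigD1_seq i) ?lB //= sphi_sv // scale1r big_seq_cond big1 ?addr0 ?subrr //.
move=> j /andP[jl ji]; rewrite oS ?scale0r //; first exact: lS.
exact/eqP.
Qed.

Lemma subsp_compl p : subsp (@compl p).
Proof.
split=> [i _|a x y Cx Cy i Si]; first exact: sphi0.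
by rewrite sphi_lin Cx ?Cy // mulr0 addr0.
Qed.

Definition cspace p : {vspace M p} := projT1 (cid (subsp_vspace (subsp_compl p))).

Lemma cspaceP p x : compl x <-> x \in cspace p.
Proof. by rewrite /cspace; case: cid. Qed.

Lemma compl_mv p q (x : M p) : ple p q -> compl x -> compl (mv M p q x).
Proof.
move=> pq Cx i Si; have [Bq|nBq] := pselect (Bp i q); last exact: sphi_out.
by rewrite sphi_mv // Cx.
Qed.

Definition cmv p q : {linear subvs_of (cspace p) -> subvs_of (cspace q)} :=
  (vsproj (cspace q) \o (mv M p q \o vsval))%FUN.

Lemma cmvE p q (x : subvs_of (cspace p)) : ple p q -> vsval (cmv p q x) = mv M p q (vsval x).
Proof.
move=> pq; rewrite /cmv /= vsprojK //; apply/cspaceP/compl_mv => //.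
exact/cspaceP/subvsP.
Qed.

Lemma cmv_id p x : cmv p p x = x.
Proof. by apply: val_inj => /=; rewrite cmvE // mv_id. Qed.

Lemma cmv_comp p q r : ple p q -> ple q r -> forall x, cmv q r (cmv p q x) = cmv p r x.
Proof.
move=> pq qr x; apply: val_inj => /=; rewrite !cmvE // ?mv_comp //.
exact: ple_trans qr.
Qed.

Definition complement : pmodule k P :=
  @PModule k P (fun p => subvs_of (cspace p)) cmv cmv_id cmv_comp.

(** A lift in [M] is corrected by [cproj], which commutes with the maps and fixes vectors of the
    complement. *)
Lemma mexact_complement : mexact M -> mexact complement.
Proof.
move=> ex a b c d bx cy_ dx dy ab ac u v uv.
have bd : ple b d by move: ab ac; coord.
have cd : ple c d by move: ab ac; coord.
have [w [wb wc]] : exists w, mv M a b w = vsval u /\ mv M a c w = vsval v.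
  by apply: (ex a b c d) => //; rewrite -!cmvE //; congr vsval.
have fa := full_seqP a; set l := full_seq a in fa.
have lS : forall i, i \in l -> S i by case: fa.
have Cw : cproj l w \in cspace a by apply/cspaceP/cproj_compl.
exists (vsproj (cspace a) (cproj l w)); split; apply: val_inj => /=;
  rewrite cmvE // vsprojK // cproj_mv ?wb ?wc // cproj_id //; exact/cspaceP/subvsP.
Qed.

(** The retraction of [t] is composed with the projection onto the complement. The two conclusions
    are what keeps [S] orthogonal when [s] is added. *)
Lemma extend_summand (t : summand complement) : exists s : summand M,
  (forall p, compl (sv s p)) /\ (forall i, S i -> forall p, sphi s (sv i p) = 0).
Proof.
have phi_mv p q (x : M p) : ple p q ->
    vsproj (cspace q) (cproj (full_seq q) (mv M p q x)) =
    cmv p q (vsproj (cspace p) (cproj (full_seq p) x)).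
  move=> pq; have [up pS pB] := full_seqP p; have [uq qS qB] := full_seqP q.
  (* The lists chosen at [p] and [q] may differ; their union is full at both points. *)
  pose l := undup (full_seq p ++ full_seq q).
  have lS i : i \in l -> S i by rewrite mem_undup mem_cat => /orP[/pS|/qS].
  have fp : full S p l.
    by split=> [||i Si Bi]; rewrite ?undup_uniq // mem_undup mem_cat pB.
  have fq : full S q l.
    by split=> [||i Si Bi]; rewrite ?undup_uniq // mem_undup mem_cat qB ?orbT.
  rewrite (cproj_full _ (full_seqP p) fp) (cproj_full _ (full_seqP q) fq).
  have Cp : cproj l x \in cspace p by apply/cspaceP/cproj_compl.
  have Cq : cproj l (mv M p q x) \in cspace q by apply/cspaceP/cproj_compl.
  by apply: val_inj => /=; rewrite cmvE // !vsprojK // cproj_mv.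
pose psi p (x : M p) := sphi t (vsproj (cspace p) (cproj (full_seq p) x) : complement p).
have [s0 [s0v s0phi]] : exists s : summand M,
  (forall p, sv s p = vsval (sv t p)) /\ (forall p (x : M p), sphi s x = psi p x).
  refine (ex_intro _ (@Summand _ _ M (sB t) (fun p => vsval (sv t p)) psi _ _ _ _ _ _ _ _)
    (conj (fun _ => erefl) (fun _ _ => erefl))).
  + exact: sB_block.
  + exact: sB_pt.
  + by move=> p nB; rewrite sv_out // linear0.
  + by move=> p q Bp pq; rewrite -cmvE //; congr vsval; apply: (sv_mv (M := complement)).
  + move=> p a x y; rewrite /psi.
    have -> : cproj (full_seq p) (a *: x + y) = a *: cproj (full_seq p) x + cproj (full_seq p) y.
      rewrite /cproj scalerBr addrACA -opprD scaler_sumr -big_split; congr (_ - _).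
      by apply: eq_bigr => i _; rewrite sphi_lin scalerDl scalerA.
    by rewrite linearP; apply: (sphi_lin t).
  + by move=> p x nB; apply: sphi_out.
  + by move=> p q x Bq pq; rewrite /psi phi_mv //; apply: (sphi_mv (M := complement)).
  + move=> p Bp; rewrite /psi.
    rewrite cproj_id; last by apply/cspaceP/subvsP.
      by rewrite vsvalK sphi_sv.
    by case: (full_seqP p).
exists s0; split=> [p|i Si p]; first by rewrite s0v; apply/cspaceP/subvsP.
rewrite s0phi /psi cproj_sv ?linear0 //; [exact: (sphi0 (M := complement))|exact: full_seqP].
Qed.

End Complement.

Lemma maximal_orthogonal : mexact M ->
  exists S, orthogonal S /\ forall p (x : M p), (forall i, S i -> sphi i x = 0) -> x = 0.
Proof.
move=> ex.
have [|||A [S0 AS0] Aok Atot|S [oS Smax]] := @zorn_pred _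
  (fun S S' : summand M -> Prop => forall i, S i -> S' i) orthogonal (fun _ => False).
- by [].
- by [].
- by move=> S1 S2 S3 h12 h23 i /h12 /h23.
- exists (fun i => exists S, A S /\ S i); split; last by move=> S AS i Si; exists S.
  move=> i j [S1 [AS1 S1i]] [S2 [AS2 S2j]].
  by have [h|h] := Atot _ _ AS1 AS2; [apply: (Aok _ AS2) => //|apply: (Aok _ AS1) => //]; apply: h.
exists S; split=> // p x Cx; apply: contrapT => x0.
have Ux : x \in cspace S p by apply/cspaceP.
have [|t] := @exists_summand (complement S) p (vsproj (cspace S p) x) (mexact_complement oS ex).
  by move=> /(congr1 vsval); rewrite vsprojK // linear0.
have [s [sC sS]] := extend_summand oS t.
(* By maximality [s] is in [S], so its retraction kills its own generator, against [sphi_sv]. *)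
have Ss : S s.
  apply: (Smax (fun i => S i \/ i = s)); [|by left|by right].
  move=> i j [Si|->] [Sj|->] ij q //.
  - exact: oS.
  - exact: sC.
  - exact: sS.
have [q Bq] := sB_pt s.
by have := sC q s Ss; rewrite sphi_sv // => /eqP; rewrite oner_eq0.
Qed.

End Decomposition.

(** * Modules over up-closed subsets of the real plane *)

Section Concrete.
Variables (k : fieldType) (Q : pt2 -> Prop).
Hypothesis upQ : forall p q, le2 p q -> Q p -> Q q.
Variables (Msp : sub_pt Q -> vectType k)
  (Mmap : forall p q : sub_pt Q, le_sub p q -> {linear Msp p -> Msp q}).
Hypothesis pM : is_pmod Mmap.

Definition sub_plane : plane := @Plane (sub_pt Q)
  (fun p => fst (proj1_sig p)) (fun p => snd (proj1_sig p))
  (fun p x y hx hy => exist _ (exist Q (x, y) (upQ (conj hx hy : le2 (proj1_sig p) (x, y)) (proj2_sig p)))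
    (conj erefl erefl)).

Definition sub_mv (p q : sub_plane) : {linear Msp p -> Msp q} :=
  if pselect (le_sub p q) is left h then Mmap h else \0.

Lemma sub_mvE (p q : sub_plane) (h : le_sub p q) x : sub_mv p q x = Mmap h x.
Proof. by rewrite /sub_mv; case: pselect => // h'; rewrite (Prop_irrelevance h' h). Qed.

Lemma sub_mv_id (p : sub_plane) x : sub_mv p p x = x.
Proof. by rewrite (sub_mvE (ple_refl p)) pM.1. Qed.

Lemma sub_mv_comp (p q r : sub_plane) : ple p q -> ple q r ->
  forall x, sub_mv q r (sub_mv p q x) = sub_mv p r x.
Proof.
move=> pq qr x; rewrite (sub_mvE pq) (sub_mvE qr) (sub_mvE (ple_trans pq qr)).
by rewrite (pM.2 p q r pq qr).
Qed.

Definition sub_pmodule : pmodule k sub_plane := PModule sub_mv_id sub_mv_comp.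

Lemma sub_mexact : middle_exact Mmap -> mexact sub_pmodule.
Proof.
move=> ex a b c d bx cy_ dx dy ab ac u v.
have bd : ple b d by move: ab ac; coord.
have cd : ple c d by move: ab ac; coord.
have [_ /(_ u v) lift] := ex a b c d ab ac bd cd bx cy_ dx dy.
rewrite /= (sub_mvE bd) (sub_mvE cd) => uv; have [|w [wb wc]] := lift; first by rewrite uv subrr.
by exists w; rewrite (sub_mvE ab) (sub_mvE ac).
Qed.

(** The coordinates of a vector are its values under the retractions in [S]. Their common kernel is
    zero, [exists_full] gives finite support, and finite sums of generators realise every admissible
    family. *)
Lemma middle_exact_decomposition : middle_exact Mmap -> block_decomposable Mmap.
Proof.
move=> ex; have [S [oS Sinj]] := maximal_orthogonal (sub_mexact ex).
pose I := {i : summand sub_pmodule | S i}.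
have ptE (p : sub_plane) : (cx p, cy p) = proj1_sig p by rewrite /=; case: (proj1_sig p).
exists I, (fun i => sB (sval i)); split.
  move=> [i Si] /=; split; first exact: sB_block.
  by have [p Bp] := sB_pt i; exists (proj1_sig p); split; [rewrite -ptE|exact: proj2_sig].
have Iinj (i j : I) : sval i = sval j -> i = j.
  by case: i j => [i Si] [j Sj] /= ij; subst j; rewrite (Prop_irrelevance Si Sj).
exists (fun p x i => sphi (sval i) (x : sub_pmodule p)); split; [|split; [|split]].
- by move=> p a x y i; apply: (sphi_lin (sval i)).
- move=> p x y xy; apply/eqP; rewrite -subr_eq0; apply/eqP/(Sinj p) => i Si.
  have := congr1 (fun f => f (exist _ i Si)) xy => /= {}xy.
  by rewrite addrC -scaleN1r (sphi_lin i) xy mulN1r addNr.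
- move=> p g; split.
    move=> [x <-]; split; last first.
      move=> i nz; apply: contrapT => nB; apply: nz; apply: sphi_out; by rewrite ptE.
    have [l [_ lS lB]] := exists_full (p : sub_plane) oS.
    have [l' l'P] : exists l' : list I, forall i : I, sval i \in l -> In i l'.
      elim: l {lS lB} => [|h l [l' IH]]; first by exists nil.
      have [Sh|nSh] := pselect (S h).
        exists (exist _ h Sh :: l')%list => i; rewrite in_cons => /orP[/eqP ih|/IH]; [left|by right].
        exact: Iinj.
      exists l' => i; rewrite in_cons => /orP[/eqP ih|/IH //].
      by case: nSh; rewrite -ih; case: i {ih}.
    exists l' => i nl'; apply: sphi_out => Bi; apply: nl'; apply: l'P.
    by apply: lB => //; case: i {Bi}.
  move=> [[l lg] gB].
  pose J : eqType := {classic I}.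
  have [l' [ul' l'g]] : exists l' : seq J, uniq l' /\ forall i : I, ((i : J) \in l') = false -> g i = 0.
    exists (undup (l : seq J)); split=> [|i]; first exact: undup_uniq.
    rewrite mem_undup => il; apply: lg => iIn; move: il.
    suff -> : (i : J) \in (l : seq J) by [].
    elim: l iIn => [//|h l IH] /= [->|/IH il]; rewrite in_cons ?eqxx // il orbT //.
  exists (\sum_(i <- l') g i *: (sv (sval (i : I)) p : Msp p)); apply: funext => j.
  rewrite (@scalar_sum k J (Msp p) (fun x => sphi (sval j) (x : sub_pmodule p)) _ _ _ j) //.
  + case: ifPn => [jl|/negPf /l'g -> //].
    have [Bj|nBj] := pselect (sB (sval j) (cx (p : sub_plane), cy (p : sub_plane))); first by rewrite sphi_sv ?mulr1.
    have -> : g j = 0 by apply: contrapT => gj; apply: nBj; rewrite ptE; apply: gB.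
    by rewrite mul0r.
  + exact: (sphi_lin (sval j)).
  + move=> i _ /eqP ij; apply: oS; [by case: j {ij}|by case: i {ij}|].
    by move=> /Iinj ji; apply: ij.
- move=> p q h x i; rewrite -(sub_mvE h); split.
    by rewrite -!ptE => -[Bp Bq]; apply: (sphi_mv (M := sub_pmodule)).
  (* If [q] is in the block then [p] is not, so the coordinate is already zero at [p]. *)
  rewrite -!ptE => nB; have [Bq|nBq] := pselect (sB (sval i) (cx (q : sub_plane), cy (q : sub_plane))); last exact: sphi_out.
  rewrite (sphi_mv (M := sub_pmodule)) // sphi_out // => Bp.
  by apply: nB.
Qed.

End Concrete.

Theorem theorem1p4 :
  (forall (k : fieldType) (Msp : sub_pt Tset -> vectType k)
          (Mmap : forall p q : sub_pt Tset, le_sub p q -> {linear Msp p -> Msp q}),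
      is_pmod Mmap -> middle_exact Mmap -> block_decomposable Mmap) /\
  (forall (k : fieldType) (Nsp : sub_pt Tbar -> vectType k)
          (Nmap : forall p q : sub_pt Tbar, le_sub p q -> {linear Nsp p -> Nsp q}),
      is_pmod Nmap -> middle_exact Nmap -> block_decomposable Nmap).
Proof.
split=> k Msp Mmap pM ex; apply: middle_exact_decomposition => //.
- by move=> p q; rewrite /le2 /Tset; lra.
- by move=> p q; rewrite /le2 /Tbar; lra.
Qed.
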